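(* Let $T\in\mathcal{T}_{\mathrm{BV}}$. If $T$ is not topologically transitive, then there exist $p,q\in\mathbb{N}$ and a regular $p,q$-invariant graph for $T$ (equivalently, a $p,q$-invariant open tube for $T$). In particular, $\rho_T$ depends rationally on $\omega$: $\rho_T=\frac{k}{q}\omega+\frac{l}{pq}\bmod1$ for suitable integers $k,l$.
   Context: $\mathbb{T}^1=\mathbb{R}/\mathbb{Z}$, $\mathbb{T}^2=\mathbb{T}^1\times\mathbb{T}^1$, $\omega\in[0,1)$ irrational. $\mathcal{T}_{\mathrm{BV}}$: maps $T(\theta,x)=(\theta+\omega,T_\theta(x))$ on $\mathbb{T}^2$, homotopic to the identity, with fibre maps orientation-preserving $C^1$ circle diffeomorphisms, $DT_\theta(x)$ continuous in $(\theta,x)$, and $V(T):=\int_{\mathbb{T}^1}V_\theta\,d\theta<\infty$, where $V_\theta$ is the total variation of $\log DT_\theta$ over the circle. $T$ is topologically transitive if for all nonempty open $U,V\subseteq\mathbb{T}^2$ there is $n\in\mathbb{N}$ with $T^{-n}U\cap V\neq\emptyset$. Fibrewise rotation number: for a lift $\hat T$ of $T$ to $\mathbb{T}^1\times\mathbb{R}$, $\rho_T:=\lim_{n\to\infty}\frac1n(\hat T^n_\theta(\hat x)-\hat x)\bmod1$ (exists, independent of $\theta,\hat x$, lift). $q$-curve: point set $\{(\hat\theta\bmod1,\hat\gamma(\hat\theta)\bmod1):\hat\theta\in\mathbb{R}\}$ of a continuous $\hat\gamma:\mathbb{R}\to\mathbb{R}$ with $\hat\gamma(\hat\theta+q)-\hat\gamma(\hat\theta)\in\mathbb{Z}$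 constant and $\hat\gamma(\hat\theta+l)-\hat\gamma(\hat\theta)\notin\mathbb{Z}$ for $1\le l<q$; it meets each fibre in points $\gamma_1(\theta),\dots,\gamma_q(\theta)$. An open $T$-invariant set $U$ is a $1,q$-invariant open tube if each fibre $U_\theta$ consists of $q$ disjoint nonempty open intervals and $U$ is connected; if $U^1$ is a $1,q$-invariant open tube for $T^p$ and $U^i:=T^{i-1}(U^1)$, $i=1,\dots,p$, are pairwise disjoint, $U=\bigcup_iU^i$ is a $p,q$-invariant open tube. Each $U^i$ contains a $q$-curve $\gamma^i$ with exactly one of its points in each interval of $U^i_\theta$. A regular $p,q$-invariant graph is the boundary line of a $p,q$-invariant open tube: $\varphi^i_j(\theta)=\gamma^i_j(\theta)+\inf\{x\in[0,1):\gamma^i_j(\theta)+x\notin U_\theta\}$ (or the analogous lower boundary $\gamma^i_j(\theta)-\sup\{x\in[0,1):\gamma^i_j(\theta)-x\notin U_\theta\}$). *)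

(* Defs.v *)
From HB Require Import structures.
From mathcomp Require Import all_boot all_order all_algebra.
From mathcomp Require Import all_classical all_reals all_analysis.
Set Implicit Arguments. Unset Strict Implicit. Unset Printing Implicit Defensive.
Import Order.TTheory GRing.Theory Num.Theory.
Import numFieldNormedType.Exports.
Local Open Scope ring_scope.
Local Open Scope classical_set_scope.

Section Defs.
Context {R : realType}.

Definition irrational (w : R) : Prop := ~ exists r : rat, w = ratr r.

(** The torus T^2 = R^2/Z^2 is handled through lifts: a point of T^2 is
    represented by any of its lifts in R * R, a subset of T^2 by its full
    preimage in R * R, i.e. a Z^2-periodic subset of R * R.
    A map T(θ,x) = (θ+ω, T_θ(x)) homotopic to the identity is represented by
    a lift F : R -> R -> R of the fibre maps with F (θ+1) x = F θ x and
    F θ (x+1) = F θ x + 1; its lift to R * R is [skew_lift w F]. *)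
Definition skew_lift (w : R) (F : R -> R -> R) (z : R * R) : R * R :=
  (z.1 + w, F z.1 z.2).

Definition fib_iter (w : R) (F : R -> R -> R) (n : nat) (t x : R) : R :=
  (iter n (skew_lift w F) (t, x)).2.

Definition fibre_var (F : R -> R -> R) (t : R) : \bar R :=
  total_variation 0 1 (fun x => ln (derive1 (F t) x)).

Definition in_T_BV (w : R) (F : R -> R -> R) : Prop :=
  [/\ continuous (fun z : R * R => F z.1 z.2),
      (forall t x, F (t + 1) x = F t x),          (* homotopic to identity *)
      (forall t x, F t (x + 1) = F t x + 1),
      [/\ (forall t x, derivable (F t) x 1),
      continuous (fun z : R * R => derive1 (F z.1) z.2)
    & (forall t x, 0 < derive1 (F t) x)
    ] & (\int[@lebesgue_measure R]_(t in `[0%R, 1%R]) fibre_var F t < +oo)%E ].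

Definition periodic_set (U : set (R * R)) : Prop :=
  forall (z : R * R) (m n : int), U z <-> U (z.1 + m%:~R, z.2 + n%:~R).

Definition torus_open (U : set (R * R)) : Prop := periodic_set U /\ open U.

(** connectedness of a subset of T^2 (subspace of the quotient topology) *)
Definition torus_connected (U : set (R * R)) : Prop :=
  forall A B, torus_open A -> torus_open B -> U `<=` A `|` B ->
    U `&` A `&` B = set0 -> U `&` A = set0 \/ U `&` B = set0.

Definition top_transitive (w : R) (F : R -> R -> R) : Prop :=
  forall U V : set (R * R), torus_open U -> torus_open V ->
    U !=set0 -> V !=set0 ->
    exists n : nat, (0 < n)%N /\ exists z, V z /\ U (iter n (skew_lift w F) z).

(** each fibre U_θ consists of q disjoint nonempty open intervals of the
    circle (a_j, b_j) + Z, j < q, cyclically ordered *)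
Definition fibre_q_intervals (U : set (R * R)) (q : nat) : Prop :=
  forall t : R, exists a b : nat -> R,
    [/\ (forall j, (j < q)%N -> a j < b j),
        (forall j, (j.+1 < q)%N -> b j <= a j.+1),
        ((0 < q)%N -> b q.-1 <= a 0%N + 1)
      & (forall x, U (t, x) <->
          exists j (m : int), (j < q)%N /\ a j < x + m%:~R < b j) ].

Definition tube1 (G : R * R -> R * R) (q : nat) (U : set (R * R)) : Prop :=
  [/\ torus_open U,
      (forall z, U z <-> U (G z)),
      fibre_q_intervals U q
    & torus_connected U ].

Definition pq_tube (w : R) (F : R -> R -> R) (p q : nat) (U : set (R * R)) : Prop :=
  exists U1 : set (R * R),
    [/\ tube1 (iter p (skew_lift w F)) q U1,
        (forall i j, (i < j)%N -> (j < p)%N ->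
           (iter i (skew_lift w F) @` U1) `&` (iter j (skew_lift w F) @` U1) = set0)
      & U = \bigcup_(i in [set i | (i < p)%N]) (iter i (skew_lift w F) @` U1) ].

End Defs.

(* Main.v *)
(** Let V and U be boxes such that no forward iterate of V meets U. If the n-th iterate
    of a horizontal line of V climbed by 1 over the base of U it would cross U, so the
    displacements of F^n at any two points differ by a bounded amount: there is rho with
    |F^n_t(x) - x - n rho| bounded, and h = sup_n (F^n_t(x) - n rho) conjugates the second
    coordinate to the translation by rho.

    Suppose w, rho and 1 are rationally independent. Since the iterates of V never cross U,
    comparing h = sup and the corresponding inf (one lower, one upper semicontinuous) over
    the dense set of translations n(w,rho) - (a,b) forces h to be affine in t and constant
    in x on U. So the images of (a small part of) U are ordered in each fibre
    by a linear functional of (n,a,b); in particular they are pairwise disjoint, and at times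
    n of closest return so are the first n images of the arc joining U to its n-th
    preimage. Integrating the Denjoy distortion estimate over the base then
    bounds the masses of the n-th and the (-n)-th image of U away from 0 for infinitely many
    n, although these masses have a finite sum.

    Hence d rho = k w + l with d minimal. The open sets between consecutive integer levels
    of d h - k t (with the upper boundary replaced by its lower semicontinuous
    regularisation, i.e. an interior) are permuted by F and by the deck translations, and none
    is empty over any t; gathering the levels divisible by p = gcd(d, k) gives the
    tube, with q = d / p. *)

Require Import Defs.
From HB Require Import structures.
From mathcomp Require Import all_boot all_order all_algebra.
From mathcomp Require Import all_classical all_reals all_analysis.
From mathcomp Require Import ring lra zify.
Set Implicit Arguments. Unset Strict Implicit. Unset Printing Implicit Defensive.
Import Order.TTheory GRing.Theory Num.Theory.
Import numFieldNormedType.Exports.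
Local Open Scope ring_scope.
Local Open Scope classical_set_scope.

(** * Iterates of a skew product *)

Section FibreHomeo.
Context {R : realType}.
Implicit Types (w t x y : R) (F : R -> R -> R).

Lemma continuous2_comp (T : topologicalType) (G : R -> R -> R) (f g : T -> R) (z : T) :
  continuous (fun z : R * R => G z.1 z.2) ->
  {for z, continuous f} -> {for z, continuous g} ->
  {for z, continuous (fun z => G (f z) (g z))}.
Proof.
move=> Gc fz gz; have G2 := Gc (f z, g z).
exact: (continuous2_cvg _ G2 fz gz).
Qed.

(** The purely topological part of [in_T_BV]. It is stable under composition and inversion, so every
    iterate of either sign satisfies it. *)
Record fibre_homeo F : Prop := FibreHomeo {
  fibre_cont : continuous (fun z : R * R => F z.1 z.2);
  fibre_per : forall t x, F (t + 1) x = F t x;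
  fibre_deg : forall t x, F t (x + 1) = F t x + 1;
  fibre_mono : forall t x y, x < y -> F t x < F t y }.

(** [get] selects some preimage, with a default value if there is none; [fibre_invK] and [fibreK]
    show that under [fibre_homeo] it is a genuine inverse. *)
Definition fibre_inv F t y : R := get [set x | F t x = y].

Lemma periodic_int (f : R -> R) : (forall t, f (t + 1) = f t) ->
  forall t (m : int), f (t + m%:~R) = f t.
Proof.
move=> fp; have nat_case (k : nat) t : f (t + k%:R) = f t.
  by elim: k t => [|k IH] t; rewrite ?addr0// -natr1 addrA fp IH.
move=> t [k|k]; first exact: nat_case.
by rewrite NegzE mulrNz -[in RHS](subrK k.+1%:R t) nat_case.
Qed.

Lemma degree_one_int (f : R -> R) : (forall x, f (x + 1) = f x + 1) ->
  forall x (m : int), f (x + m%:~R) = f x + m%:~R.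
Proof.
move=> fd x m; have fp t : f (t + 1) - (t + 1) = f t - t by rewrite fd; lra.
by have /= := periodic_int fp x m; lra.
Qed.

Lemma continuous_slice F : continuous (fun z : R * R => F z.1 z.2) ->
  forall t, continuous (F t).
Proof.
move=> Fc t x; apply: (@continuous2_comp _ F (fun=> t) id x Fc); last exact: cvg_id.
exact: cst_continuous.
Qed.

Section Inverse.
Variable F : R -> R -> R.
Hypothesis hF : fibre_homeo F.

(** Surjectivity: by degree one, [F t] sends the integer [m] to [F t 0 + m], so the intermediate
    value theorem applies between two consecutive integers. *)
Lemma fibre_invK t y : F t (fibre_inv F t y) = y.
Proof.
apply: (@getPex _ [set x | F t x = y]).
pose m : int := Num.floor (y - F t 0).
have ml : m%:~R <= y - F t 0 by exact: floor_le.
have mr : y - F t 0 < (m + 1)%:~R by exact: floorD1_gt.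
have le : m%:~R <= (m + 1)%:~R :> R by rewrite ler_int lerDl.
have cont : {within `[m%:~R, (m + 1)%:~R], continuous (F t)}.
  by apply: continuous_subspaceT; exact: (continuous_slice (fibre_cont hF)).
have E (k : int) : F t k%:~R = F t 0 + k%:~R.
  by rewrite -[k%:~R in LHS]add0r; exact: (degree_one_int (fibre_deg hF t)).
have [|c _ <-] := IVT le cont (v := y); last by exists c.
rewrite !E ge_min le_max; apply/andP; split; apply/orP; [left|right]; lra.
Qed.

Lemma fibre_lt t x y : (F t x < F t y) = (x < y).
Proof.
apply/idP/idP; last exact: fibre_mono.
case: (ltgtP x y) => // [/(fibre_mono hF t)|->]; last by rewrite ltxx.
by move=> /lt_trans/[apply]; rewrite ltxx.
Qed.

Lemma fibreK t x : fibre_inv F t (F t x) = x.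
Proof.
have h := fibre_invK t (F t x).
apply/eqP; rewrite eq_le !leNgt -(fibre_lt t) h ltxx /=.
by rewrite -(fibre_lt t) h ltxx.
Qed.

Lemma fibre_inv_homeo : fibre_homeo (fibre_inv F).
Proof.
split.
(* Joint continuity: the inverse image of [y] stays within [e] of [x0] exactly when [y] lies between
   [F t (x0 - e)] and [F t (x0 + e)], an open condition on [(t, y)]. *)
- move=> [t0 y0] /=; apply/cvgrPdist_lt => /= e e0.
  set x0 := fibre_inv F t0 y0.
  have lo : F t0 (x0 - e) < y0 by rewrite -[ltRHS](fibre_invK t0) fibre_lt -/x0; lra.
  have hi : y0 < F t0 (x0 + e) by rewrite -[ltLHS](fibre_invK t0) fibre_lt -/x0; lra.
  have C x : continuous (fun z : R * R => z.2 - F z.1 x).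
    move=> z; apply: cvgB; first exact: cvg_snd.
    apply: (@continuous2_comp _ F fst (fun=> x) z (fibre_cont hF)).
      exact: cvg_fst.
    exact: cst_continuous.
  have : \forall z \near (t0, y0), 0 < z.2 - F z.1 (x0 - e).
    by apply: (cvgr_gt _ (C (x0 - e) (t0, y0))); rewrite /= subr_gt0.
  have : \forall z \near (t0, y0), z.2 - F z.1 (x0 + e) < 0.
    by apply: (cvgr_lt _ (C (x0 + e) (t0, y0))); rewrite /= subr_lt0.
  apply: filterS2 => -[t y] /=; rewrite subr_gt0 subr_lt0.
  have -> : (F t (x0 - e) < y) = (x0 - e < fibre_inv F t y) by rewrite -[RHS](fibre_lt t) fibre_invK.
  have -> : (y < F t (x0 + e)) = (fibre_inv F t y < x0 + e) by rewrite -[RHS](fibre_lt t) fibre_invK.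
  move=> a b.
  by rewrite ltr_norml; apply/andP; split; lra.
- by move=> t y; rewrite /fibre_inv; congr (get _); apply/seteqP; split => x /=;
    rewrite (fibre_per hF).
- move=> t y; rewrite -[in LHS](fibre_invK t y) -(fibre_deg hF).
  by rewrite fibreK.
- by move=> t x y xy; rewrite -(fibre_lt t) !fibre_invK.
Qed.

End Inverse.

(** The fibre map of the inverse skew product: the preimage of a point over [t] lies over
    [t - w]. *)
Definition back w F t y := fibre_inv F (t - w) y.

Lemma back_homeo w F : fibre_homeo F -> fibre_homeo (back w F).
Proof.
move=> /fibre_inv_homeo h; split.
- move=> z.
  apply: (@continuous2_comp _ (fibre_inv F) (fun z => z.1 - w) snd z (fibre_cont h)).
    by apply: cvgB; [exact: cvg_fst|exact: cvg_cst].
  exact: cvg_snd.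
- by move=> t x; rewrite /back -[t + 1 - w]addrAC (fibre_per h).
- by move=> t x; rewrite /back (fibre_deg h).
- by move=> t x y xy; apply: (fibre_mono h).
Qed.

(** [Negz n] stands for [- (n + 1)], whence the [n.+1] backward steps. *)
Definition skew_iter w F (n : int) (z : R * R) : R * R :=
  match n with
  | Posz n => iter n (skew_lift w F) z
  | Negz n => iter n.+1 (skew_lift (- w) (back w F)) z
  end.

Definition Phi w F (n : int) t x : R := (skew_iter w F n (t, x)).2.

Section Iterates.
Variables (w : R) (F : R -> R -> R).
Hypothesis hF : fibre_homeo F.

Local Notation T := (skew_lift w F).
Local Notation T' := (skew_lift (- w) (back w F)).
Local Notation Ti := (skew_iter w F).
Local Notation Ph := (Phi w F).

Lemma skew_liftK : cancel T T'.
Proof. by move=> [t x]; rewrite /skew_lift /back /= addrK fibreK. Qed.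

Lemma skew_liftK' : cancel T' T.
Proof. by move=> [t x]; rewrite /skew_lift /back /= subrK fibre_invK. Qed.

Lemma skew_iterS n z : Ti (n + 1) z = T (Ti n z).
Proof.
case: n => [n|[|n]].
- by rewrite -PoszD addn1.
- by rewrite (_ : Negz 0 + 1 = 0) //= skew_liftK'.
- have -> : Negz n.+1 + 1 = Negz n by rewrite !NegzE; lia.
  by rewrite /= skew_liftK'.
Qed.

Lemma skew_iterP n z : Ti (n - 1) z = T' (Ti n z).
Proof. by rewrite -[n in RHS](subrK 1) skew_iterS skew_liftK. Qed.

Lemma int_ind_step (P : int -> Prop) : P 0 -> (forall n, P n -> P (n + 1)) ->
  (forall n, P n -> P (n - 1)) -> forall n, P n.
Proof.
move=> P0 PS PP; case=> n.
  by elim: n => // n /PS; rewrite -PoszD addn1.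
elim: n => [|n]; first exact: (PP 0 P0).
move=> /PP; suff -> : Negz n - 1 = Negz n.+1 by [].
by rewrite !NegzE; lia.
Qed.

Lemma skew_iterD m n z : Ti (m + n) z = Ti m (Ti n z).
Proof.
elim/int_ind_step: m => [|m IH|m IH]; first by rewrite add0r.
- by rewrite addrAC !skew_iterS IH.
- by rewrite addrAC !skew_iterP IH.
Qed.

Lemma skew_iterE n t x : Ti n (t, x) = (t + n%:~R * w, Ph n t x).
Proof.
rewrite /Phi; suff : (Ti n (t, x)).1 = t + n%:~R * w by case: (Ti _ _) => ? ? /= ->.
elim/int_ind_step: n => [|n IH|n IH]; first by rewrite /= mul0r addr0.
- by rewrite skew_iterS /= IH; rewrite intrD; lra.
- by rewrite skew_iterP /= IH; rewrite intrD; lra.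
Qed.

Lemma PhiD m n t x : Ph (m + n) t x = Ph m (t + n%:~R * w) (Ph n t x).
Proof. by rewrite {1}/Phi skew_iterD skew_iterE. Qed.

Lemma Phi0 t x : Ph 0 t x = x. Proof. by []. Qed.

Lemma Phi1 t x : Ph 1 t x = F t x. Proof. by []. Qed.

Lemma PhiS n t x : Ph (n + 1) t x = F (t + n%:~R * w) (Ph n t x).
Proof. by rewrite addrC PhiD. Qed.

Lemma PhiP n t x : Ph (n - 1) t x = back w F (t + n%:~R * w) (Ph n t x).
Proof. by rewrite addrC PhiD. Qed.

Lemma Phi_nat n t x : Ph n%:Z t x = fib_iter w F n t x. Proof. by []. Qed.

Lemma Phi_iter n t x : iter n (skew_lift w F) (t, x) = (t + n%:R * w, Ph n t x).
Proof. exact: (skew_iterE n). Qed.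

Lemma PhiK n t x : Ph (- n) (t + n%:~R * w) (Ph n t x) = x.
Proof. by rewrite -PhiD addNr. Qed.

Lemma Phi_homeo n : fibre_homeo (Ph n).
Proof.
have step (G G' : R -> R -> R) v : fibre_homeo G -> fibre_homeo G' ->
    fibre_homeo (fun t x => G (t + v) (G' t x)).
  move=> g g'; split.
  - move=> z.
    apply: (@continuous2_comp _ G (fun z => z.1 + v) (fun z => G' z.1 z.2) z (fibre_cont g)).
      by apply: cvgD; [exact: cvg_fst|exact: cvg_cst].
    exact: (fibre_cont g').
  - by move=> t x; rewrite addrAC (fibre_per g) (fibre_per g').
  - by move=> t x; rewrite (fibre_deg g') (fibre_deg g).
  - by move=> t x y xy; apply: (fibre_mono g); apply: (fibre_mono g').
elim/int_ind_step: n => [|n IH|n IH].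
- by split => //; move=> z; exact: cvg_snd.
- rewrite (_ : Ph (n + 1) = fun t x => F (t + n%:~R * w) (Ph n t x)); first exact: step.
  by apply/funext => t; apply/funext => x; rewrite PhiS.
- rewrite (_ : Ph (n - 1) = fun t x => back w F (t + n%:~R * w) (Ph n t x)).
    by apply: step => //; exact: back_homeo.
  by apply/funext => t; apply/funext => x; rewrite PhiP.
Qed.

Lemma Phi_cont n : continuous (fun z : R * R => Ph n z.1 z.2).
Proof. exact: fibre_cont (Phi_homeo n). Qed.

Lemma Phi_cont_base n x : continuous (fun t => Ph n t x).
Proof.
move=> t; have c : {for t, continuous (fun=> x : R)} by exact: cst_continuous.
have i : {for t, continuous (@id R)} by exact: cvg_id.
exact: (continuous2_comp (@Phi_cont n) i c).
Qed.

Lemma Phi_per n t (m : int) x : Ph n (t + m%:~R) x = Ph n t x.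
Proof. exact: (periodic_int (fun t => fibre_per (Phi_homeo n) t x)). Qed.

Lemma Phi_deg n t x (m : int) : Ph n t (x + m%:~R) = Ph n t x + m%:~R.
Proof. exact: (degree_one_int (fibre_deg (Phi_homeo n) t)). Qed.

Lemma Phi_lt n t x y : (Ph n t x < Ph n t y) = (x < y).
Proof. exact: (fibre_lt (Phi_homeo n)). Qed.

Lemma Phi_le n t x y : (Ph n t x <= Ph n t y) = (x <= y).
Proof. by rewrite !leNgt Phi_lt. Qed.

End Iterates.
End FibreHomeo.

(** * Density of the translations *)

Section Diophantine.
Context {R : realType}.
Implicit Types (x y w e t g rho : R).

Lemma irrational_int w (a b : int) : irrational w ->
  a%:~R * w = b%:~R -> a = 0 /\ b = 0.
Proof.
move=> wi ab; have [a0|a0] := eqVneq a 0.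
  by split=> //; move/eqP: ab; rewrite a0 mul0r eq_sym intr_eq0 => /eqP.
exfalso; apply: wi; exists (b%:~R / a%:~R) => //.
have -> : ratr (b%:~R / a%:~R) = b%:~R / a%:~R :> R.
  by rewrite rmorphM /= fmorphV /= !ratr_int.
by rewrite -ab mulrAC divff ?mul1r // intr_eq0.
Qed.

(** Pigeonhole: among [K * K + 1] multiples of [(x, y)], two have fractional parts in the same of
    [K * K] square cells of side [1 / K < e]; their difference is the required multiple. *)
Lemma dirichlet2 x y e : 0 < e -> exists n a b : int,
  [/\ 0 < n, `|n%:~R * x - a%:~R| < e & `|n%:~R * y - b%:~R| < e].
Proof.
move=> e0; pose K := (Num.trunc e^-1).+1.
have K0 : 0 < K%:R :> R by rewrite ltr0n.
have Ke : K%:R^-1 < e.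
  by rewrite invf_plt ?posrE// truncnS_gt// invr_ge0 ltW.
pose fr (u : R) := u - (Num.floor u)%:~R.
have fr0 u : 0 <= fr u by rewrite subr_ge0 floor_le.
have fr1 u : fr u < 1.
  by rewrite ltrBlDr; have := floorD1_gt u; rewrite intrD addrC.
pose cell (u : R) : 'I_K := inord (Num.trunc (K%:R * fr u)).
have cellP u v : cell u = cell v -> `|fr u - fr v| < e.
  have nK z : (Num.trunc (K%:R * fr z) < K)%N.
    rewrite truncn_lt_nat ?mulr_ge0 ?ler0n// -[ltRHS]mulr1 ltr_pM2l//.
  move=> /(congr1 val); rewrite /cell /= !inordK // => E.
  have b z : (Num.trunc (K%:R * fr z))%:R <= K%:R * fr z < (Num.trunc (K%:R * fr z)).+1%:R.
    by apply: truncn_itv; rewrite mulr_ge0 ?ler0n.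
  apply: lt_trans Ke; rewrite -(ltr_pM2l K0) divff ?gt_eqF// -[K%:R in X in X < _](gtr0_norm K0).
  rewrite -normrM mulrBr; have := b u; have := b v; rewrite E -!natr1 ltr_norml.
  by move=> /andP[? ?] /andP[? ?]; apply/andP; split; lra.
pose f (i : 'I_(K * K).+1) := (cell (i%:R * x), cell (i%:R * y)).
have /fintype.injectivePn[i [j ij [E1 E2]]] : ~~ injectiveb f.
  by apply/negP => /injectiveP/leq_card; rewrite card_prod !card_ord ltnn.
wlog {ij} ij : i j E1 E2 / (i < j)%N.
  move=> W; case: (ltngtP i j) => [|ji|/val_inj/eqP]; first exact: (W i j).
    by apply: (W j i) => //.
  by rewrite (negbTE ij).
exists (j%:Z - i%:Z), (Num.floor (j%:R * x) - Num.floor (i%:R * x)),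
  (Num.floor (j%:R * y) - Num.floor (i%:R * y)); split.
- by rewrite subr_gt0.
- have := cellP _ _ E1; rewrite distrC; congr (`| _ | < _); rewrite /fr !intrB.
  by rewrite -!pmulrn; ring.
- have := cellP _ _ E2; rewrite distrC; congr (`| _ | < _); rewrite /fr !intrB.
  by rewrite -!pmulrn; ring.
Qed.

(** Approximating the multiples [M * x] and [M * y] with [M > N] yields a time divisible by [M],
    hence a large one. *)
Lemma dirichlet2_large x y e (N : int) : 0 < e -> exists n a b : int,
  [/\ N < n, 0 < n, `|n%:~R * x - a%:~R| < e & `|n%:~R * y - b%:~R| < e].
Proof.
move=> e0; pose M : int := `|N| + 1.
have [n [a [b [n0 ha hb]]]] := dirichlet2 (M%:~R * x) (M%:~R * y) e0.
exists (n * M), a, b; rewrite intrM -!mulrA; split => //.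
  by rewrite (@lt_le_trans _ _ M) // /M; nia.
by rewrite mulr_gt0 // /M; lia.
Qed.

(** Some [m] rotations amount to a nonzero step [b] shorter than [e]. Repeating this step at most
    about [1 / |b|] times goes once around the circle, so the waiting time is bounded uniformly in
    [t]. *)
Lemma dense_rotation_bounded w e : irrational w -> 0 < e ->
  exists N : nat, forall t, exists (j : nat) (a : int),
    (j <= N)%N /\ `|t + j%:R * w - a%:~R| < e.
Proof.
move=> wi e0; have [n [a [_ [n0 ha _]]]] := dirichlet2 w w e0.
set b := n%:~R * w - a%:~R in ha.
have b0 : b != 0.
  apply/eqP => /eqP; rewrite subr_eq0 => /eqP /(irrational_int wi)[n0' _].
  by rewrite n0' ltxx in n0.
have bn0 : 0 < `|b| by rewrite normr_gt0.
have [m nE] : exists m : nat, n = m%:Z by exists `|n|%N; lia.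
subst n.
pose C := (Num.trunc (`|b|^-1)).+1.
(* y is the distance to cover in the direction of b *)
have key t : exists (y : R) (c : int), [/\ 0 <= y, y <= 1 & t = c%:~R - Num.sg b * y].
  case: (ltrgt0P b) b0 => // b0 _.
    exists (1 - (t - (Num.floor t)%:~R)), (Num.floor t + 1).
    have := floor_le t; have := floorD1_gt t; rewrite intrD gtr0_sg // => ? ?.
    by split; lra.
  exists (t - (Num.floor t)%:~R), (Num.floor t).
  have := floor_le t; have := floorD1_gt t; rewrite intrD ltr0_sg // => ? ?.
  by split; lra.
exists (C * m)%N => t; have [y [c [y0 y1 ->]]] := key t.
pose k := Num.trunc (y / `|b|).
have yb : 0 <= y / `|b| by rewrite divr_ge0 // ltW.
have /andP[k1 k2] := truncn_itv yb; rewrite -/k in k1 k2.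
exists (k * m)%N, (c + k%:Z * a); split.
  rewrite leq_mul2r; apply/orP; right.
  have : k%:R < C%:R :> R.
    apply: le_lt_trans k1 _; apply: (@le_lt_trans _ _ `|b|^-1).
      by rewrite ler_piMl // invr_ge0 ltW.
    by rewrite truncnS_gt // invr_ge0 ltW.
  by rewrite ltr_nat => /ltnW.
have kb1 : k%:R * `|b| <= y by rewrite -ler_pdivlMr.
have kb2 : y < k%:R * `|b| + `|b|.
  by rewrite -[X in _ + X]mul1r -mulrDl natr1 -ltr_pdivrMr.
have -> : c%:~R - Num.sg b * y + (k * m)%:R * w - (c + k%:Z * a)%:~R
    = Num.sg b * (k%:R * `|b| - y).
  rewrite intrD intrM natrM mulrBr [Num.sg b * (_ * _)]mulrCA -numEsg /b -!pmulrn; ring.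
rewrite normrM normr_sg b0 mul1r ltr_norml; apply/andP; split; lra.
Qed.

Definition rationally_related w rho := exists A B C : int,
  B != 0 /\ A%:~R * w + B%:~R * rho + C%:~R = 0.

(** Two small translations [(x1, y1)] and [(x2, y2)] that are linearly independent span a fine
    lattice. The target is rounded to a lattice point by taking floors of its coordinates. *)
Lemma dense_rotation2 w rho t g e : irrational w -> ~ rationally_related w rho ->
  0 < e -> exists n a b : int,
  [/\ 0 < n, `|n%:~R * w - a%:~R - t| < e & `|n%:~R * rho - b%:~R - g| < e].
Proof.
move=> wi ind e0; pose e' := e / 3; have e'0 : 0 < e' by rewrite divr_gt0.
have [n1 [a1 [b1 [n10 ha1 hb1]]]] := dirichlet2 w rho e'0.
set x1 := _ - _ in ha1; set y1 := _ - _ in hb1.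
have n1R : 0 < n1%:~R :> R by rewrite ltr0z.
have x10 : 0 < `|x1| / n1%:~R.
  rewrite divr_gt0 // normr_gt0; apply/eqP => /eqP; rewrite subr_eq0 => /eqP.
  by move=> /(irrational_int wi)[n0' _]; rewrite n0' ltxx in n10.
(* A vanishing determinant is an integer relation whose coefficient of [rho] is [a2 * n1 - a1 * n2].
   If that were zero too, [|x2|] would be at least [|x1| / n1], which this tolerance excludes. *)
have e2 : 0 < Num.min e' (`|x1| / n1%:~R) by rewrite lt_min e'0.
have [n2 [a2 [b2 [n20 ]]]] := dirichlet2 w rho e2.
set x2 := n2%:~R * w - _; set y2 := n2%:~R * rho - _; rewrite !lt_min => /andP[ha2 ha2'] /andP[hb2 _].
have D0 : x1 * y2 - x2 * y1 != 0.
  apply/eqP => D0; have := ind; apply; exists (n2 * b1 - n1 * b2), (a2 * n1 - a1 * n2), (a1 * b2 - a2 * b1).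
  split; last by rewrite -[RHS]D0 /x1 /x2 /y1 /y2 !intrB !intrM; ring.
  apply/eqP => E; have {}E : (a2 * n1)%:~R = (a1 * n2)%:~R :> R.
    by congr (_%:~R); lia.
  have E' : n1%:~R * x2 = n2%:~R * x1.
    by rewrite /x1 /x2 !mulrBr; move: E; rewrite !intrM => E; lra.
  move: ha2'; rewrite ltr_pdivlMr // mulrC -[n1%:~R in X in X < _](gtr0_norm n1R) -normrM E' normrM.
  rewrite gtr0_norm ?ltr0z// gtr_pMl ?ltr0z//; last by move: x10; rewrite pmulr_lgt0 ?invr_gt0.
  by rewrite ltrz1; lia.
set D := _ - _ in D0.
pose x := (t * y2 - g * x2) / D; pose y := (g * x1 - t * y1) / D.
have Et : x * x1 + y * x2 = t by rewrite /x /y /D; field.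
have Eg : x * y1 + y * y2 = g by rewrite /x /y /D; field.
pose p := Num.floor x; pose q := Num.floor y.
(* The rounded combination may have a negative time; adding a long, nearly trivial return makes the
   total time positive. *)
have [n3 [a3 [b3 [hn _ ha3 hb3]]]] := dirichlet2_large w rho (- (p * n1 + q * n2)) e'0.
exists (p * n1 + q * n2 + n3), (p * a1 + q * a2 + a3), (p * b1 + q * b2 + b3).
have px : 0 <= x - p%:~R <= 1.
  by have := floor_le x; have := floorD1_gt x; rewrite intrD -/p => ? ?; lra.
have qy : 0 <= y - q%:~R <= 1.
  by have := floor_le y; have := floorD1_gt y; rewrite intrD -/q => ? ?; lra.
have bnd u v (c d z : R) : 0 <= u <= 1 -> 0 <= v <= 1 -> `|c| < e' -> `|d| < e' ->
    `|z| < e' -> `|z - u * c - v * d| < e.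
  move=> /andP[u0 u1] /andP[v0 v1] hc hd hz.
  have -> : e = e' + e' + e' by rewrite /e'; field.
  apply: le_lt_trans (ler_normB _ _) _; rewrite ltr_leD //.
    apply: le_lt_trans (ler_normB _ _) _; rewrite ltr_leD //.
    rewrite normrM ger0_norm // (le_trans _ (ltW hc)) // ler_piMl //.
  by rewrite normrM ger0_norm // (le_trans _ (ltW hd)) // ler_piMl.
split; first by rewrite addrC -ltrBlDr sub0r.
- have -> : (p * n1 + q * n2 + n3)%:~R * w - (p * a1 + q * a2 + a3)%:~R - t
    = (n3%:~R * w - a3%:~R) - (x - p%:~R) * x1 - (y - q%:~R) * x2.
    by rewrite -Et /x1 /x2 !intrD !intrM; ring.
  exact: bnd.
- have -> : (p * n1 + q * n2 + n3)%:~R * rho - (p * b1 + q * b2 + b3)%:~R - g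
    = (n3%:~R * rho - b3%:~R) - (x - p%:~R) * y1 - (y - q%:~R) * y2.
    by rewrite -Eg /y1 /y2 !intrD !intrM; ring.
  exact: bnd.
Qed.

End Diophantine.

(** * Bounded deviations *)

Section Deviation.
Context {R : realType}.
Variables (w : R) (F : R -> R -> R).
Hypothesis hF : fibre_homeo F.
Hypothesis wi : irrational w.
Local Notation Ph := (Phi w F).

(* Lifts of two boxes U and V of half-width r such that no forward iterate of V meets U. *)
Definition never_meets (tU xU tV xV r : R) := forall (n a b : int) (t x : R),
  0 < n -> `|t - tV| < r -> `|x - xV| < r ->
  `|t + n%:~R * w - a%:~R - tU| < r -> `|Ph n t x - b%:~R - xU| < r -> False.

Lemma not_transitive_boxes : ~ top_transitive w F ->
  exists tU xU tV xV r : R, 0 < r /\ never_meets tU xU tV xV r.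
Proof.
move=> nt; apply: contrapT => C; apply: nt => U V [perU oU] [perV oV].
move=> [[tU xU] Uz] [[tV xV] Vz]; apply: contrapT => nex; apply: C.
have := open_nbhs_nbhs (conj oU Uz) => /nbhs_ballP[rU /= rU0 bU].
have := open_nbhs_nbhs (conj oV Vz) => /nbhs_ballP[rV /= rV0 bV].
exists tU, xU, tV, xV, (Num.min rU rV); split; first by rewrite lt_min rU0.
move=> n a b t x n0; rewrite !lt_min => /andP[_ ht] /andP[_ hx] /andP[ht' _] /andP[hx' _].
apply: nex; exists `|n|%N; split; first by rewrite absz_gt0 gt_eqF.
exists (t, x); split.
  by apply: bV; split; rewrite /ball /= distrC.
have -> : iter `|n|%N (skew_lift w F) (t, x) = (t + n%:~R * w, Ph n t x).
  by rewrite Phi_iter // -[n in RHS](gtz0_abs n0).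
apply/(perU _ (- a) (- b)); apply: bU; split; rewrite /ball /= distrC mulrNz //.
Qed.

Section Boxes.
Variables tU xU tV xV r : R.
Hypothesis r0 : 0 < r.
Hypothesis nm : never_meets tU xU tV xV r.

(** By the intermediate value theorem, the image of the horizontal line at height [y] of V passes
    through height [x + b], and it does so over the base of U. *)
Lemma no_crossing (n a b : int) t t' x y : 0 < n -> `|y - xV| < r ->
  `|t - tV| < r -> `|t' - tV| < r ->
  `|t + n%:~R * w - a%:~R - tU| < r -> `|t' + n%:~R * w - a%:~R - tU| < r ->
  `|x - xU| < r -> Ph n t y <= x + b%:~R -> x + b%:~R <= Ph n t' y -> False.
Proof.
move=> n0 hy ht ht' hu hu' hx le1 le2.
have cont u v : {within `[u, v], continuous (fun s => Ph n s y)}.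
  by apply: continuous_subspaceT; exact: Phi_cont_base.
have [c cP cE] : exists2 c, (t <= c <= t') || (t' <= c <= t) & Ph n c y = x + b%:~R.
  have [tt'|/ltW tt'] := leP t t'.
    have [|c] := IVT tt' (@cont t t') (v := x + b%:~R).
      by rewrite ge_min le1 le_max le2 orbT.
    by rewrite in_itv /= => h <-; exists c; rewrite // h.
  have [|c] := IVT tt' (@cont t' t) (v := x + b%:~R).
    by rewrite ge_min le1 orbT le_max le2.
  by rewrite in_itv /= => h <-; exists c; rewrite // h orbT.
have btw u v z : (u <= c <= v) || (v <= c <= u) -> `|u - z| < r -> `|v - z| < r -> `|c - z| < r.
  rewrite !ltr_norml => h /andP[? ?] /andP[? ?].
  by case/orP: h => /andP[? ?]; apply/andP; split; lra.
apply: (@nm n a b c y) => //; first exact: btw cP ht ht'.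
  have E u : u + n%:~R * w - a%:~R - tU = u - (tU + a%:~R - n%:~R * w) by ring.
  by rewrite E; apply: (btw _ _ _ cP); rewrite -E.
by rewrite cE addrK.
Qed.

Lemma box_oscillation (n a : int) t t' : 0 < n ->
  `|t - tV| < r -> `|t' - tV| < r ->
  `|t + n%:~R * w - a%:~R - tU| < r -> `|t' + n%:~R * w - a%:~R - tU| < r ->
  Ph n t' xV - Ph n t xV < 1.
Proof.
move=> n0 ht ht' hu hu'; rewrite ltNge; apply/negP => le.
(* With a climb of at least 1, the translate [xU + b] lies between the two values. *)
pose b := Num.floor (Ph n t' xV - xU).
have b1 := floor_le (Ph n t' xV - xU); have b2 := floorD1_gt (Ph n t' xV - xU).
rewrite -/b intrD in b1 b2.
apply: (@no_crossing n a b t t' xU xV); rewrite ?subrr ?normr0//; lra.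
Qed.

Definition displ (n : int) t x := Ph n t x - x.

Lemma displ_fibre n t x x' : `|displ n t x - displ n t x'| <= 1.
Proof.
pose m := Num.floor (x - x').
have m1 := floor_le (x - x'); have m2 := floorD1_gt (x - x').
rewrite -/m intrD in m1 m2.
have : Ph n t (x' + m%:~R) <= Ph n t x by rewrite Phi_le //; lra.
have : Ph n t x <= Ph n t (x' + (m + 1)%:~R) by rewrite Phi_le // intrD; lra.
rewrite !Phi_deg // intrD /displ => ? ?.
by rewrite ler_norml; apply/andP; split; lra.
Qed.

Lemma displ_bounded1 : exists2 C : R, 0 <= C & forall t x, `|F t x - x| <= C.
Proof.
have cont (f : R -> R) : continuous f -> {within `[0, 1], continuous f}.
  by move=> ?; exact: continuous_subspaceT.
have c1 := @Phi_cont_base _ w F hF 1 0.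
have [c _ hc] := EVT_max ler01 (cont _ c1).
have [d _ hd] := EVT_min ler01 (cont _ c1).
exists (`|F c 0| + `|F d 0| + 1) => [|t x]; first by rewrite !addr_ge0.
pose s := t - (Num.floor t)%:~R.
have s01 : s \in `[0, 1]%R.
  rewrite in_itv /= /s; have := floor_le t; have := floorD1_gt t; rewrite intrD => ? ?.
  by apply/andP; split; lra.
have Fs : F t 0 = F s 0.
  by rewrite -(Phi1 w F s) -(Phi_per w hF 1 s (Num.floor t)) /s subrK.
have := displ_fibre 1 t x 0; rewrite /displ !Phi1 subr0 Fs.
have := hc _ s01; have := hd _ s01; rewrite !Phi1.
have := ler_norm (F c 0); have := ler_norm (- F d 0); rewrite normrN.
rewrite !ler_norml => ? ? ? ? /andP[? ?].
have := normr_ge0 (F d 0); have := normr_ge0 (F c 0).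
by move=> ? ?; apply/andP; split; lra.
Qed.

Lemma displD (m n : int) t x :
  displ (m + n) t x = displ m (t + n%:~R * w) (Ph n t x) + displ n t x.
Proof. by rewrite /displ PhiD //; ring. Qed.

Lemma displ_per n t (a : int) x : displ n (t + a%:~R) x = displ n t x.
Proof. by rewrite /displ Phi_per. Qed.

Lemma displ_bounded : exists2 C : R, 0 <= C & forall (n : nat) t x, `|displ n t x| <= n%:R * C.
Proof.
have [C C0 hC] := displ_bounded1; exists C; first by [].
move=> n; elim: n => [|n IH] t x.
  by rewrite /displ subrr normr0 mul0r.
rewrite -add1n PoszD displD natrD mulrDl mul1r.
by apply: le_trans (ler_normD _ _) _; apply: lerD; [exact: hC|exact: IH].
Qed.

(** Both points reach the base of V within [N] steps, and a common number [m] of further steps takes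
    both to the same translate of the base of U. There [box_oscillation] compares them; the leftover
    steps number at most [2 * N]. *)
Lemma displ_uniform : exists K : R, forall (n : nat) t t' x x',
  `|displ n t x - displ n t' x'| <= K.
Proof.
have [C C0 hC] := displ_bounded.
have r4 : 0 < r / 4 by rewrite divr_gt0.
have [N hN] := dense_rotation_bounded wi r4.
have hNV t : exists (j : nat) (a : int), (j <= N)%N /\ `|t + j%:R * w - a%:~R - tV| < r / 4.
  have [j [a [jN ja]]] := hN (t - tV); exists j, a; split => //.
  by rewrite (_ : _ - _ = t - tV + j%:R * w - a%:~R) //; ring.
(* Twice the error [3 * (N * C) + 1] of [approx], plus 1 from [box_oscillation]. *)
exists (6 * (N%:R * C) + 3) => n t t' x x'.
have NC : 0 <= N%:R * C by rewrite mulr_ge0.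
have [nN|nN] := leqP n (2 * N).
  apply: le_trans (ler_normB _ _) _.
  have hn u y : `|displ n u y| <= 2 * (N%:R * C).
    apply: le_trans (hC _ _ _) _; rewrite mulrA ler_wpM2r // -natrM ler_nat //.
  by have := hn t x; have := hn t' x'; lra.
have [j [a [jN ja]]] := hNV t; have [j' [a' [jN' ja']]] := hNV t'.
set s := t + _ - _ in ja; set s' := t' + _ - _ in ja'.
have [i [b [iN ib]]] := hN (s + (n - 2 * N)%:R * w - tU).
(* [i] is found from [s] alone; it also serves [s'], since the quarter radii leave [s'] within
   [3 * r / 4] of the target. *)
pose m := (n - 2 * N + i)%N.
have m0 : (0 < m)%N by rewrite addn_gt0 subn_gt0 nN.
have ms : `|s + m%:~R * w - b%:~R - tU| < r / 4.
  by rewrite (_ : _ - _ = s + (n - 2 * N)%:R * w - tU + i%:R * w - b%:~R) // -pmulrn natrD; ring.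
have approx u (k : nat) (c : int) y : (k <= N)%N ->
    `|displ n u y - displ m (u + k%:R * w - c%:~R) xV| <= 3 * (N%:R * C) + 1.
  move=> kN; have nE : n%:Z = (n - m - k)%N%:Z + (m%:Z + k%:Z).
    rewrite -!PoszD; congr Posz; rewrite /m in m0 *; lia.
  rewrite nE !displD.
  have := hC (n - m - k)%N (u + (m%:Z + k%:Z)%:~R * w) (Ph (m%:Z + k%:Z) u y).
  have := hC k u y.
  have := displ_fibre m (u + k%:R * w) (Ph k u y) xV.
  rewrite -(displ_per m (u + k%:R * w) (- c) xV) mulrNz.
  have : k%:R * C <= N%:R * C by rewrite ler_wpM2r // ler_nat.
  have : (n - m - k)%:R * C <= 2 * (N%:R * C).
    rewrite mulrA ler_wpM2r // -natrM ler_nat /m; lia.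
  rewrite -pmulrn !ler_norml => ? ? /andP[? ?] /andP[? ?] /andP[? ?].
  by apply/andP; split; lra.
have sV : `|s - tV| < r by apply: lt_le_trans ja _; lra.
have sV' : `|s' - tV| < r by apply: lt_le_trans ja' _; lra.
have sU : `|s + m%:~R * w - b%:~R - tU| < r by apply: lt_le_trans ms _; lra.
have sU' : `|s' + m%:~R * w - b%:~R - tU| < r.
  move: ja ja' ms; rewrite !ltr_norml => /andP[? ?] /andP[? ?] /andP[? ?].
  by apply/andP; split; lra.
have o1 := @box_oscillation m b s s' m0 sV sV' sU sU'.
have o2 := @box_oscillation m b s' s m0 sV' sV sU' sU.
have := approx t j a x jN; have := approx t' j' a' x' jN'.
rewrite -/s -/s' /displ !ler_norml => /andP[? ?] /andP[? ?].
by apply/andP; split; lra.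
Qed.

(** Comparing [a (n * m)] with both [n * a m] and [m * a n] shows that each [(a n - K) / n] lies
    below each [(a m + K) / m]; [rho] is the supremum of the former. *)
Lemma quasi_additive_slope (a : nat -> R) (K : R) :
  (forall n m, `|a (n + m)%N - a n - a m| <= K) ->
  exists rho : R, forall n, `|a n - n%:R * rho| <= K.
Proof.
move=> qa.
have mul n m : `|a (n.+1 * m)%N - n.+1%:R * a m| <= n%:R * K.
  elim: n => [|n IH]; first by rewrite mul1n mul1r subrr normr0 mul0r.
  have := qa (n.+1 * m)%N m; rewrite -mulSnr => h.
  have -> : a (n.+2 * m)%N - n.+2%:R * a m =
    (a (n.+2 * m)%N - a (n.+1 * m)%N - a m) + (a (n.+1 * m)%N - n.+1%:R * a m).
    by rewrite -(natr1 n.+1); ring.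
  have -> : n.+1%:R * K = K + n%:R * K by rewrite -natr1; ring.
  by apply: le_trans (ler_normD _ _) _; apply: lerD.
pose S := [set (a n.+1 - K) / n.+1%:R | n in [set: nat]].
have ub n : ubound S ((a n.+1 + K) / n.+1%:R).
  move=> _ [m _ <-]; rewrite ler_pdivrMr ?ltr0n// mulrAC ler_pdivlMr ?ltr0n//.
  have := mul m n.+1; have := mul n m.+1; rewrite mulnC !ler_norml => /andP[? ?] /andP[? ?].
  have K0 : 0 <= K := le_trans (normr_ge0 _) (qa 0%N 0%N).
  by rewrite -!natr1; lra.
have sS : has_sup S.
  split; first by exists ((a 1%N - K) / 1); exists 0%N.
  by eexists; exact: (ub 0%N).
exists (sup S) => -[|n].
  have := qa 0%N 0%N; rewrite addn0 mul0r subr0 -normrN.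
  by congr (`| _ | <= _); ring.
have n0 : 0 < n.+1%:R :> R by rewrite ltr0n.
have l1 : (a n.+1 - K) / n.+1%:R <= sup S by apply: sup_upper_bound => //; exists n.
have l2 : sup S <= (a n.+1 + K) / n.+1%:R by apply: ge_sup => //; case: sS.
move: l1 l2; rewrite ler_pdivrMr // ler_pdivlMr // mulrC => l1.
rewrite mulrC => l2; rewrite ler_norml; apply/andP; split; lra.
Qed.

Lemma bounded_deviation_boxes : exists rho M : R,
  forall n t x, `|Ph n t x - x - n%:~R * rho| <= M.
Proof.
have [K hK] := displ_uniform.
have [n m|rho hr] := @quasi_additive_slope (fun n => displ n 0 0) K.
  by rewrite PoszD displD [X in `|X|](_ : _ = displ n (0 + m%:~R * w) (Ph m 0 0) - displ n 0 0) //; ring.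
exists rho, (K + K) => n t x.
have pos (m : nat) u y : `|Ph m u y - y - m%:R * rho| <= K + K.
  have := hK m u 0 y 0; have := hr m; rewrite {2}/displ.
  rewrite !ler_norml => /andP[? ?] /andP[? ?]; apply/andP; split; lra.
case: n => n; first exact: pos.
(* A negative iterate is estimated by the positive one that undoes it, started at its endpoint. *)
rewrite NegzE; have := pos n.+1 (t + (- n.+1%:Z)%:~R * w) (Ph (- n.+1%:Z) t x).
have := PhiK w hF (- n.+1%:Z) t x; rewrite opprK => ->.
rewrite -normrN; congr (`| _ | <= _); rewrite mulrNz -pmulrn; ring.
Qed.

End Boxes.
End Deviation.

(** * Semiconjugacy to a translation *)

Section Semiconjugacy.
Context {R : realType}.
Variables (w : R) (F : R -> R -> R).
Hypothesis hF : fibre_homeo F.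
Local Notation Ph := (Phi w F).

(* Up to bounded error the skew product is the translation by (w, rho); h reads off the second coordinate of that translation. *)
Record semiconj (rho M : R) (h : R -> R -> R) : Prop := Semiconj {
  semiconj_mono : forall t x y, x <= y -> h t x <= h t y;
  semiconj_iter : forall n t x, h (t + n%:~R * w) (Ph n t x) = h t x + n%:~R * rho;
  semiconj_per : forall t x (a : int), h (t + a%:~R) x = h t x;
  semiconj_deg : forall t x (b : int), h t (x + b%:~R) = h t x + b%:~R;
  semiconj_near : forall t x, `|h t x - x| <= M }.

Lemma semiconj_lt rho M h t x y : semiconj rho M h -> h t x < h t y -> x < y.
Proof. by move=> hs; rewrite !ltNge; apply: contra; exact: (semiconj_mono hs). Qed.

Lemma semiconj_lift rho M h (n a b : int) t x : semiconj rho M h ->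
  h (t + n%:~R * w - a%:~R) (Ph n t x - b%:~R) = h t x + (n%:~R * rho - b%:~R).
Proof.
move=> hs.
have := semiconj_per hs (t + n%:~R * w - a%:~R) (Ph n t x - b%:~R) a.
have := semiconj_deg hs (t + n%:~R * w) (Ph n t x - b%:~R) b.
by rewrite !subrK (semiconj_iter hs) => ? <-; lra.
Qed.

Variables (rho M : R).
Hypothesis dev : forall n t x, `|Ph n t x - x - n%:~R * rho| <= M.

(** The whole two-sided orbit is taken, so that applying the map merely reindexes the set and shifts
    it by [rho]. *)
Definition orbit_dev t x := [set Ph n t x - n%:~R * rho | n in [set: int]].
Definition hsup t x := sup (orbit_dev t x).
Definition hinf t x := inf (orbit_dev t x).

Lemma orbit_dev0 t x : orbit_dev t x !=set0.
Proof. by exists (Ph 0 t x - 0%:~R * rho); exists 0. Qed.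

Lemma orbit_dev_bound t x z : orbit_dev t x z -> x - M <= z <= x + M.
Proof.
move=> [n _ <-]; have := dev n t x; rewrite ler_norml => /andP[? ?].
by apply/andP; split; lra.
Qed.

Lemma has_sup_orbit_dev t x : has_sup (orbit_dev t x).
Proof.
by split; [exact: orbit_dev0|exists (x + M) => z /orbit_dev_bound/andP[]].
Qed.

Lemma has_inf_orbit_dev t x : has_inf (orbit_dev t x).
Proof.
by split; [exact: orbit_dev0|exists (x - M) => z /orbit_dev_bound/andP[]].
Qed.

Lemma hsup_ge n t x : Ph n t x - n%:~R * rho <= hsup t x.
Proof. by apply: sup_upper_bound; [exact: has_sup_orbit_dev|exists n]. Qed.

Lemma hinf_le n t x : hinf t x <= Ph n t x - n%:~R * rho.
Proof. by apply: ge_inf; [exact: (has_inf_orbit_dev t x).2|exists n]. Qed.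

Lemma hsup_le t x c : (forall n, Ph n t x - n%:~R * rho <= c) -> hsup t x <= c.
Proof. by move=> h; apply: ge_sup; [exact: orbit_dev0|move=> _ [n _ <-]]. Qed.

Lemma hinf_ge t x c : (forall n, c <= Ph n t x - n%:~R * rho) -> c <= hinf t x.
Proof. by move=> h; apply: lb_le_inf; [exact: orbit_dev0|move=> _ [n _ <-]]. Qed.

(** Each equality is one inequality used twice, for a translation and for its inverse. *)
Lemma hsup_semiconj : semiconj rho M hsup.
Proof.
have hit n t x : hsup (t + n%:~R * w) (Ph n t x) <= hsup t x + n%:~R * rho.
  apply: hsup_le => m; rewrite -PhiD // -lerBlDr.
  by apply: le_trans (hsup_ge (m + n) t x); rewrite intrD; lra.
have hper t x (a : int) : hsup (t + a%:~R) x <= hsup t x.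
  by apply: hsup_le => n; rewrite Phi_per //; exact: hsup_ge.
have hdeg t x (b : int) : hsup t (x + b%:~R) <= hsup t x + b%:~R.
  by apply: hsup_le => n; rewrite Phi_deg //; have := hsup_ge n t x; lra.
split.
- move=> t x y xy; apply: hsup_le => n.
  by apply: le_trans (hsup_ge n t y); rewrite lerB // Phi_le.
- move=> n t x; apply/eqP; rewrite eq_le hit /=.
  have := hit (- n) (t + n%:~R * w) (Ph n t x).
  by rewrite PhiK // !mulrNz !mulNr addrK; lra.
- move=> t x a; apply/eqP; rewrite eq_le hper /=.
  by have := hper (t + a%:~R) x (- a); rewrite mulrNz addrK.
- move=> t x b; apply/eqP; rewrite eq_le hdeg /=.
  by have := hdeg t (x + b%:~R) (- b); rewrite mulrNz addrK; lra.
- move=> t x; rewrite ler_norml; apply/andP; split.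
    have := hsup_ge 0 t x; have := dev 0 t x.
    by rewrite mul0r !subr0 Phi0 subrr normr0; lra.
  rewrite lerBlDr; apply: hsup_le => n.
  by have /orbit_dev_bound : orbit_dev t x (Ph n t x - n%:~R * rho) by [exists n]; lra.
Qed.

Lemma hinf_semiconj : semiconj rho M hinf.
Proof.
have hit n t x : hinf t x + n%:~R * rho <= hinf (t + n%:~R * w) (Ph n t x).
  apply: hinf_ge => m; rewrite -PhiD // -lerBrDr.
  by apply: le_trans (hinf_le (m + n) t x) _; rewrite intrD; lra.
have hper t x (a : int) : hinf t x <= hinf (t + a%:~R) x.
  by apply: hinf_ge => n; rewrite Phi_per //; exact: hinf_le.
have hdeg t x (b : int) : hinf t x + b%:~R <= hinf t (x + b%:~R).
  by apply: hinf_ge => n; rewrite Phi_deg //; have := hinf_le n t x; lra.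
split.
- move=> t x y xy; apply: hinf_ge => n.
  by apply: le_trans (hinf_le n t x) _; rewrite lerB // Phi_le.
- move=> n t x; apply/eqP; rewrite eq_le hit andbT.
  have := hit (- n) (t + n%:~R * w) (Ph n t x).
  by rewrite PhiK // !mulrNz !mulNr addrK; lra.
- move=> t x a; apply/eqP; rewrite eq_le hper andbT.
  by have := hper (t + a%:~R) x (- a); rewrite mulrNz addrK.
- move=> t x b; apply/eqP; rewrite eq_le hdeg andbT.
  by have := hdeg t (x + b%:~R) (- b); rewrite mulrNz addrK; lra.
- move=> t x; rewrite ler_norml; apply/andP; split; last first.
    have := hinf_le 0 t x; have := dev 0 t x.
    by rewrite mul0r !subr0 Phi0 subrr normr0; lra.
  rewrite lerBrDr; apply: hinf_ge => n.
  by have /orbit_dev_bound : orbit_dev t x (Ph n t x - n%:~R * rho) by [exists n]; lra.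
Qed.

(** A supremum of continuous functions: the single iterate that exceeds [c] at the point still does
    so nearby. *)
Lemma hsup_lsc c t x : c < hsup t x -> \forall z \near (t, x), c < hsup z.1 z.2.
Proof.
move=> h; have [_ [n _ <-] cn] := sup_gt (orbit_dev0 t x) h.
have : \forall z \near (t, x), c + n%:~R * rho < Ph n z.1 z.2.
  by apply: (cvgr_gt _ (@Phi_cont _ w F hF n (t, x))) => /=; rewrite -ltrBrDr.
apply: filterS => z hz; apply: lt_le_trans (hsup_ge n _ _).
by rewrite ltrBrDr.
Qed.

Lemma hsup_lsc_base c t x : c < hsup t x -> \forall s \near t, c < hsup s x.
Proof.
move=> h; have [_ [n _ <-] cn] := sup_gt (orbit_dev0 t x) h.
have : \forall s \near t, c + n%:~R * rho < Ph n s x.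
  by apply: (cvgr_gt _ (@Phi_cont_base _ w F hF n x t)) => /=; rewrite -ltrBrDr.
apply: filterS => z hz; apply: lt_le_trans (hsup_ge n _ _).
by rewrite ltrBrDr.
Qed.

Lemma hinf_usc_base c t x : hinf t x < c -> \forall s \near t, hinf s x < c.
Proof.
move=> h; have [_ [n _ <-] cn] := inf_lt (orbit_dev0 t x) h.
have : \forall s \near t, Ph n s x < c + n%:~R * rho.
  by apply: (cvgr_lt _ (@Phi_cont_base _ w F hF n x t)) => /=; rewrite -ltrBlDr.
apply: filterS => z hz; apply: le_lt_trans (hinf_le n _ _) _.
by rewrite ltrBlDr.
Qed.

End Semiconjugacy.

(** Cauchy's functional equation on an interval, with boundedness as the regularity assumption. *)
Lemma additive_bounded_linear {R : realType} (A : R -> R) (r B : R) : 0 < r ->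
  (forall d e, `|d| < r -> `|e| < r -> `|d + e| < r -> A (d + e) = A d + A e) ->
  (forall d, `|d| < r -> `|A d| <= B) ->
  exists s, forall d, `|d| <= r / 2 -> A d = s * d.
Proof.
move=> r0 add bnd; pose q := r / 2; have q0 : 0 < q by rewrite divr_gt0.
have rq : r = q + q by rewrite /q; field.
pose s := A q / q; pose E d := A d - s * d.
have Eq : E q = 0 by rewrite /E /s divfK ?subrr // gt_eqF.
have A0 : A 0 = 0.
  have := add 0 0; rewrite addr0 normr0 => /(_ r0 r0 r0) h.
  by apply: (addrI (A 0)); rewrite addr0 -h.
have lt d : 0 <= d <= q -> `|d| < r.
  by move=> /andP[d0 d1]; rewrite ger0_norm //; lra.
(* E doubles under the doubling map of the circle of length q, and it is bounded. *)
have dbl d : 0 <= d <= q -> exists2 d', 0 <= d' <= q & E d' = 2 * E d.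
  move=> dq; have [le|le] := leP (2 * d) q.
    exists (2 * d); first by lra.
    rewrite /E (_ : 2 * d = d + d); last by ring.
    by rewrite add //; [ring|exact: lt|exact: lt|apply: lt; lra].
  exists (2 * d - q); first by lra.
  have dq' : `|d - q| < r by rewrite ltr_norml; apply/andP; split; lra.
  have h1 : A (d - q + q) = A (d - q) + A q.
    by apply: add => //; [apply: lt; lra|rewrite subrK; exact: lt].
  have h2 : A (d + (d - q)) = A d + A (d - q).
    by apply: add => //; [exact: lt|rewrite (_ : d + (d - q) = 2 * d - q);
      [apply: lt; lra|ring]].
  rewrite subrK in h1; rewrite (_ : d + (d - q) = 2 * d - q) in h2; last by ring.
  by have := Eq; rewrite /E h2 => ?; lra.
pose C := B + `|s| * q.
have small k d : 0 <= d <= q -> 2 ^+ k * `|E d| <= C.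
  elim: k d => [|k IH] d dq.
    rewrite mul1r; apply: le_trans (ler_normB _ _) _; apply: lerD.
      by apply: bnd; exact: lt.
    by rewrite normrM ler_wpM2l // ger0_norm; lra.
  have [d' dq' Ed'] := dbl d dq.
  by have := IH _ dq'; rewrite Ed' normrM gtr0_norm // exprSr mulrA.
have E0 d : 0 <= d <= q -> E d = 0.
  move=> dq; apply/eqP; rewrite -normr_le0 leNgt; apply/negP => Ed.
  have C0 : 0 <= C by rewrite (le_trans _ (small 0%N d dq)) // mulr_ge0 // exprn_ge0.
  pose k := (Num.trunc (C / `|E d|)).+1.
  have h1 : C / `|E d| < k%:R by exact: truncnS_gt.
  have h2 : k%:R < 2 ^+ k :> R by rewrite -natrX ltr_nat ltn_expl.
  have := small k d dq; rewrite leNgt => /negP; apply.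
  by rewrite -ltr_pdivrMr //; exact: lt_trans h1 h2.
exists s => d; rewrite -/q ler_norml => /andP[d1 d2].
have [d0|/ltW d0] := leP 0 d.
  by apply/eqP; rewrite -subr_eq0; apply/eqP; apply: E0; lra.
have dq : 0 <= - d <= q by lra.
have := E0 _ dq; rewrite /E.
have := add d (- d); rewrite subrr normr0 normrN A0.
have dr : `|d| < r by rewrite -normrN; exact: lt.
by move=> /(_ dr dr r0) ? ?; lra.
Qed.

(** * Affinity of the semiconjugacy on a box in the rationally independent case *)

Section AffineBox.
Context {R : realType}.
Variables (w : R) (F : R -> R -> R).
Hypothesis hF : fibre_homeo F.
Hypothesis wi : irrational w.
Variables (rho M : R).
Hypothesis dev : forall n t x, `|Phi w F n t x - x - n%:~R * rho| <= M.
Hypothesis ind : ~ rationally_related w rho.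
Variables tU xU tV xV r : R.
Hypothesis r0 : 0 < r.
Hypothesis nm : never_meets w F tU xU tV xV r.
Local Notation Ph := (Phi w F).
Local Notation hp := (hsup w F rho).
Local Notation hm := (hinf w F rho).

Let sp : semiconj w F rho M hp := hsup_semiconj hF dev.
Let sm : semiconj w F rho M hm := hinf_semiconj hF dev.

Lemma near_open (P : R -> Prop) t : (\forall s \near t, P s) ->
  exists2 e, 0 < e & forall s, `|s - t| < e -> P s.
Proof.
move=> /nbhs_ballP[e /= e0 he]; exists e => // s hs; apply: he.
by rewrite /ball /= distrC.
Qed.

Lemma near_interval (t z : R) : `|t - z| < r ->
  exists2 e, 0 < e & forall s, `|s - t| < e -> `|s - z| < r.
Proof.
move=> h; exists (r - `|t - z|) => [|s hs]; first by rewrite subr_gt0.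
rewrite (_ : s - z = (s - t) + (t - z)); last by ring.
by apply: le_lt_trans (ler_normD _ _) _; lra.
Qed.

(* An approximating translation n(w,rho) - (a,b) moves the base point of U. *)
Lemma no_cross_sup_inf t1 t2 b g y : `|t1 - tV| < r -> `|t2 - tV| < r ->
  `|t1 + b - tU| < r -> `|t2 + b - tU| < r -> `|y - xU| < r ->
  hp t1 xV + g < hp (t1 + b) y -> hm (t2 + b) y < hm t2 xV + g -> False.
Proof.
move=> v1 v2 u1 u2 hy l1 l2.
pose m1 := (hp t1 xV + g + hp (t1 + b) y) / 2.
pose m2 := (hm t2 xV + g + hm (t2 + b) y) / 2.
have m1l : m1 < hp (t1 + b) y by rewrite /m1; lra.
have m2l : hm (t2 + b) y < m2 by rewrite /m2; lra.
have [e1 e10 he1] := near_open (hsup_lsc_base hF dev m1l).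
have [e2 e20 he2] := near_open (hinf_usc_base hF dev m2l).
have [e3 e30 he3] := near_interval u1.
have [e4 e40 he4] := near_interval u2.
pose e5 := m1 - (hp t1 xV + g); pose e6 := hm t2 xV + g - m2.
have e50 : 0 < e5 by rewrite /e5 /m1; lra.
have e60 : 0 < e6 by rewrite /e6 /m2; lra.
pose e := Num.min (Num.min (Num.min e1 e2) (Num.min e3 e4)) (Num.min e5 e6).
have e0 : 0 < e by rewrite !lt_min e10 e20 e30 e40 e50 e60.
have [n [a [c [n0 ]]]] := dense_rotation2 b g wi ind e0.
rewrite !lt_min => /andP[/andP[/andP[h1 h2] /andP[h3 h4]] _] /andP[_ /andP[h5 h6]].
have E u : u + n%:~R * w - a%:~R - (u + b) = n%:~R * w - a%:~R - b by ring.
apply: (no_crossing hF nm (n := n) (a := a) (b := c) (t := t1) (t' := t2) (x := y) (y := xV)) => //.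
- by rewrite subrr normr0.
- by apply: he3; rewrite E.
- by apply: he4; rewrite E.
- rewrite -lerBlDr; apply/ltW/(semiconj_lt sp (t := t1 + n%:~R * w - a%:~R)).
  rewrite (semiconj_lift _ _ _ _ _ sp).
  have : m1 < hp (t1 + n%:~R * w - a%:~R) y by apply: he1; rewrite E.
  by move: h5; rewrite ltr_norml /e5 => /andP[? ?]; lra.
- rewrite -lerBrDr; apply/ltW/(semiconj_lt sm (t := t2 + n%:~R * w - a%:~R)).
  rewrite (semiconj_lift _ _ _ _ _ sm).
  have : hm (t2 + n%:~R * w - a%:~R) y < m2 by apply: he2; rewrite E.
  by move: h6; rewrite ltr_norml /e6 => /andP[? ?]; lra.
Qed.

(* Here the approximation moves the base point of V instead, which needs the semicontinuity of the other function. *)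
Lemma no_cross_inf_sup t1 t2 b g y : `|t1 - tV| < r -> `|t2 - tV| < r ->
  `|t1 + b - tU| < r -> `|t2 + b - tU| < r -> `|y - xU| < r ->
  hm t1 xV + g < hm (t1 + b) y -> hp (t2 + b) y < hp t2 xV + g -> False.
Proof.
move=> v1 v2 u1 u2 hy l1 l2.
pose m1' := (hm t1 xV + (hm (t1 + b) y - g)) / 2.
pose m2' := (hp t2 xV + (hp (t2 + b) y - g)) / 2.
have m1l : hm t1 xV < m1' by rewrite /m1'; lra.
have m2l : m2' < hp t2 xV by rewrite /m2'; lra.
have [e1 e10 he1] := near_open (hinf_usc_base hF dev m1l).
have [e2 e20 he2] := near_open (hsup_lsc_base hF dev m2l).
have [e3 e30 he3] := near_interval v1.
have [e4 e40 he4] := near_interval v2.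
pose e5 := hm (t1 + b) y - g - m1'; pose e6 := m2' - (hp (t2 + b) y - g).
have e50 : 0 < e5 by rewrite /e5 /m1'; lra.
have e60 : 0 < e6 by rewrite /e6 /m2'; lra.
pose e := Num.min (Num.min (Num.min e1 e2) (Num.min e3 e4)) (Num.min e5 e6).
have e0 : 0 < e by rewrite !lt_min e10 e20 e30 e40 e50 e60.
have [n [a [c [n0 ]]]] := dense_rotation2 b g wi ind e0.
rewrite !lt_min => /andP[/andP[/andP[h1 h2] /andP[h3 h4]] _] /andP[_ /andP[h5 h6]].
pose s u := u + b - (n%:~R * w - a%:~R).
have E u : s u + n%:~R * w - a%:~R = u + b by rewrite /s; ring.
have E' u : `|s u - u| = `|n%:~R * w - a%:~R - b|.
  by rewrite distrC; congr (`| _ |); rewrite /s; ring.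
apply: (no_crossing hF nm (n := n) (a := a) (b := c) (t := s t1) (t' := s t2) (x := y) (y := xV)) => //.
- by rewrite subrr normr0.
- by apply: he3; rewrite E'.
- by apply: he4; rewrite E'.
- by rewrite E.
- by rewrite E.
- rewrite -lerBlDr; apply/ltW/(semiconj_lt sm (t := s t1 + n%:~R * w - a%:~R)).
  rewrite (semiconj_lift _ _ _ _ _ sm) E.
  have : hm (s t1) xV < m1' by apply: he1; rewrite E'.
  by move: h5; rewrite ltr_norml /e5 => /andP[? ?]; lra.
- rewrite -lerBrDr; apply/ltW/(semiconj_lt sp (t := s t2 + n%:~R * w - a%:~R)).
  rewrite (semiconj_lift _ _ _ _ _ sp) E.
  have : m2' < hp (s t2) xV by apply: he2; rewrite E'.
  by move: h6; rewrite ltr_norml /e6 => /andP[? ?]; lra.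
Qed.

(** If an increment of [hp] and one of [hm] differed, a [g] halfway between them would contradict
    one of the two preceding lemmas. So the increments of [hp] at [t1] and [t2] both equal the
    increment of [hm] at [t1]. *)
Lemma hsup_shift t1 t2 b y : `|t1 - tV| < r -> `|t2 - tV| < r ->
  `|t1 + b - tU| < r -> `|t2 + b - tU| < r -> `|y - xU| < r ->
  hp (t1 + b) y - hp t1 xV = hp (t2 + b) y - hp t2 xV.
Proof.
have le u v : `|u - tV| < r -> `|v - tV| < r ->
    `|u + b - tU| < r -> `|v + b - tU| < r -> `|y - xU| < r ->
    hp (u + b) y - hp u xV = hm (v + b) y - hm v xV.
  move=> v1 v2 u1 u2 hy; apply/eqP; rewrite eq_le; apply/andP; split.
    rewrite leNgt; apply/negP => L.
    pose g := (hp (u + b) y - hp u xV + (hm (v + b) y - hm v xV)) / 2.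
    by apply: (@no_cross_sup_inf u v b g y) => //; rewrite /g; lra.
  rewrite leNgt; apply/negP => L.
  pose g := (hp (u + b) y - hp u xV + (hm (v + b) y - hm v xV)) / 2.
  by apply: (@no_cross_inf_sup v u b g y) => //; rewrite /g; lra.
move=> v1 v2 u1 u2 hy.
by rewrite (le t1 t1) // (le t2 t1).
Qed.

Lemma hsup_affine_box : exists r1 s c x1 x2 : R, [/\ 0 < r1, x1 < x2 &
  forall t x, `|t - tU| <= r1 -> x1 <= x <= x2 -> hp t x = s * (t - tU) + c].
Proof.
(* By [key], the increment of [hp] under a base shift [d] is the same at all points of U; this makes
   [A] additive. *)
pose A d := hp (tV + d) xV - hp tV xV.
have z0 (z : R) : `|z - z| < r by rewrite subrr normr0.
have key d th y : `|d| < r -> `|th - tU| < r -> `|th + d - tU| < r -> `|y - xU| < r ->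
    hp (th + d) y - hp th y = A d.
  move=> hd h1 h2 hy.
  have := @hsup_shift (tV + d) tV (th - tV) y.
  rewrite (_ : tV + d - tV = d); last by ring.
  rewrite (_ : tV + d + (th - tV) = th + d); last by ring.
  rewrite (_ : tV + (th - tV) = th); last by ring.
  by move=> /(_ hd (z0 _) h2 h1 hy); rewrite /A; lra.
have tUd d : tU + d - tU = d by ring.
have [s hs] : exists s, forall d, `|d| <= r / 2 -> A d = s * d.
  apply: (additive_bounded_linear r0 (B := M + M)).
    move=> d e hd he hde.
    have := key d tU xU hd (z0 _); rewrite tUd => /(_ hd (z0 _)).
    have := key e (tU + d) xU he; rewrite tUd => /(_ hd).
    rewrite (_ : tU + d + e - tU = d + e); last by ring.
    move=> /(_ hde (z0 _)).
    have := key (d + e) tU xU hde (z0 _); rewrite tUd addrA => /(_ hde (z0 _)).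
    by lra.
  move=> d hd; have := semiconj_near sp (tV + d) xV; have := semiconj_near sp tV xV.
  by rewrite /A !ler_norml => /andP[? ?] /andP[? ?]; apply/andP; split; lra.
have r20 : 0 < r / 2 by rewrite divr_gt0.
have aff d y : `|d| <= r / 2 -> `|y - xU| < r -> hp (tU + d) y = s * d + hp tU y.
  move=> hd hy; have dr : `|d| < r by apply: le_lt_trans hd _; lra.
  by have := key d tU y dr (z0 _); rewrite tUd hs // => /(_ dr hy); lra.
exists (r / 2), s, (hp tU xU), (xU - r / 2), (xU + r / 2); split; [done|lra|].
(* If [hp] jumped between [y] and [y'], density would provide an iterate of the centre of V with
   level strictly inside the jump. By monotonicity it would lie between [y] and [y'], hence in U.
   The tolerance [D / (1 + |s|)] leaves room for the slope term [s * d]. *)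
have cst y y' : y <= y' -> `|y - xU| < r -> `|y' - xU| < r -> hp tU y = hp tU y'.
  move=> yy' hy hy'; apply/eqP; rewrite eq_le (semiconj_mono sp) //= leNgt.
  apply/negP => lt; pose D := (hp tU y' - hp tU y) / 2.
  have D0 : 0 < D by rewrite divr_gt0 // subr_gt0.
  have s1 : 0 < 1 + `|s| by rewrite ltr_pwDl.
  pose e := Num.min (r / 2) (D / (1 + `|s|)).
  have e0 : 0 < e by rewrite lt_min r20 divr_gt0.
  have [n [a [b [n0]]]] := dense_rotation2 (tU - tV) (hp tU y + D - hp tV xV) wi ind e0.
  set d := _ - (tU - tV); rewrite !lt_min => /andP[d1 d2] /andP[_ g2].
  have E : tV + n%:~R * w - a%:~R = tU + d by rewrite /d; ring.
  have hl := semiconj_lift n a b tV xV sp; rewrite E in hl.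
  have sd : `|s * d| <= `|s| * (D / (1 + `|s|)) by rewrite normrM ler_wpM2l // ltW.
  have DE : D = `|s| * (D / (1 + `|s|)) + D / (1 + `|s|).
    by rewrite -{1}[D](@divfK _ (1 + `|s|)) ?gt_eqF //; ring.
  move: sd g2; rewrite ler_norml ltr_norml => /andP[? ?] /andP[? ?].
  have h1 : y < Ph n tV xV - b%:~R.
    by apply: (semiconj_lt sp (t := tU + d)); rewrite hl aff ?(ltW d1) //; lra.
  have h2 : Ph n tV xV - b%:~R < y'.
    apply: (semiconj_lt sp (t := tU + d)); rewrite hl aff ?(ltW d1) //.
    have D2 : hp tU y' = hp tU y + 2 * D by rewrite /D; field.
    by lra.
  apply: (nm (n := n) (a := a) (b := b) (t := tV) (x := xV)) => //.
    by rewrite E tUd; apply: lt_trans d1 _; lra.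
  move: hy hy'; rewrite !ltr_norml => /andP[? ?] /andP[? ?]; apply/andP; split; lra.
move=> t x ht /andP[hx1 hx2].
have hx : `|x - xU| < r by rewrite ltr_norml; apply/andP; split; lra.
rewrite -{1}(subrK tU t) addrC aff //; congr (_ + _).
by have [xx|/ltW xx] := leP x xU; [|symmetry]; apply: cst.
Qed.

End AffineBox.

(** * Disjoint arcs and means over the circle *)

Section DisjointArcs.
Context {R : realType}.
Variable mu : R -> R -> \bar R.
Hypothesis mu_ge0 : forall a b, a <= b -> (0 <= mu a b)%E.
Hypothesis muD : forall a b c, a <= b -> b <= c -> (mu a b + mu b c <= mu a c)%E.

Definition separated (p q : R * R) := (p.2 <= q.1) || (q.2 <= p.1).

Lemma sum_separated_line (s : seq (R * R)) (c d : R) : c <= d ->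
  all (fun p => [&& c <= p.1, p.1 <= p.2 & p.2 <= d]) s -> pairwise separated s ->
  (\sum_(p <- s) mu p.1 p.2 <= mu c d)%E.
Proof.
have [n sn] := ubnP (size s); elim: n s sn c d => // n IH [_ c d cd _ _|p s].
  by rewrite big_nil mu_ge0.
rewrite ltnS => sn c d cd /= /andP[/and3P[cp pp pd] als] /andP[sep pws].
rewrite big_cons (bigID (fun q : R * R => q.2 <= p.1)) /= -[X in (_ + (X + _))%E]big_filter
  -[X in (_ + (_ + X))%E]big_filter.
set l := [seq q <- s | _]; set r := [seq q <- s | ~~ _].
have lE : (\sum_(q <- l) mu q.1 q.2 <= mu c p.1)%E.
  apply: IH => //.
  - by apply: leq_ltn_trans sn; rewrite size_filter count_size.
  - rewrite all_filter; apply: sub_all als => q /= /and3P[-> -> _].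
    by apply/implyP.
  - exact: subseq_pairwise (filter_subseq _ _) pws.
have rE : (\sum_(q <- r) mu q.1 q.2 <= mu p.2 d)%E.
  apply: IH => //.
  - by apply: leq_ltn_trans sn; rewrite size_filter count_size.
  - rewrite all_filter; have {}als := conj als sep.
    move/andP: als; rewrite -all_predI; apply: sub_all => q /= /andP[/and3P[_ -> ->]].
    by rewrite /separated /= !andbT => /orP[->|->] //; rewrite implybT.
  - exact: subseq_pairwise (filter_subseq _ _) pws.
apply: le_trans (muD cp (le_trans pp pd)).
rewrite addeCA leeD //.
by apply: le_trans (muD pp pd); rewrite leeD.
Qed.

Variable v : \bar R.
Hypothesis mu_shift : forall a c (b : int), mu (a + b%:~R) (c + b%:~R) = mu a c.
Hypothesis mu_circle : forall c, (mu c (c + 1) <= v)%E.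

(** The circle is cut at the left end of the first arc, and [b i] moves the left end of every other
    arc into the resulting unit interval. *)
Lemma sum_separated_circle (I : eqType) (J : seq I) (x y : I -> R) : uniq J ->
  (forall i, i \in J -> x i <= y i <= x i + 1) ->
  (forall i j (b : int), i \in J -> j \in J -> i != j ->
     y i + b%:~R <= x j \/ y j <= x i + b%:~R) ->
  (\sum_(i <- J) mu (x i) (y i) <= v)%E.
Proof.
case: J => [_ _ _|i0 J'].
  by rewrite big_nil; apply: le_trans (mu_circle 0); rewrite mu_ge0 // lerDl.
set J := i0 :: J' => uJ xy sep.
have i0J : i0 \in J by rewrite mem_head.
pose b i := - Num.floor (x i - x i0).
have xb i : x i0 <= x i + (b i)%:~R < x i0 + 1.
  have := floor_le (x i - x i0); have := floorD1_gt (x i - x i0).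
  by rewrite /b mulrNz intrD => ? ?; apply/andP; split; lra.
apply: le_trans (mu_circle (x i0)).
under eq_bigr => i _ do rewrite -(mu_shift _ _ (b i)).
pose f i := (x i + (b i)%:~R, y i + (b i)%:~R).
rewrite -[leLHS]/(\sum_(i <- J) mu (f i).1 (f i).2)%E.
rewrite -(big_map f xpredT (fun p => mu p.1 p.2)).
apply: sum_separated_line; first by rewrite lerDl.
- apply/allP => _ /mapP[i iJ ->] /=.
  have /andP[xy1 xy2] := xy i iJ; have /andP[xb1 xb2] := xb i.
  rewrite xb1 lerD2r xy1 /=.
  have [ii0|ni] := eqVneq i0 i.
    have b0 : b i = 0 by rewrite /b ii0 subrr floor0 oppr0.
    by rewrite b0 addr0 ii0.
  (* No arc crosses the cut: it is separated from the translate by 1 of the first arc. *)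
  have [|le] := sep i0 i (1 - b i) i0J iJ ni.
    have /andP[+ _] := xy i0 i0J; rewrite intrB => ? ?; lra.
  by move: le; rewrite intrB => ?; lra.
- rewrite pairwise_map; move: uJ; rewrite uniq_pairwise.
  apply: (@sub_in_pairwise _ (fun i => i \in J)); last exact/allP.
  move=> i j iJ jJ /= ij; rewrite /separated /=.
  have [h|h] := sep i j (b i - b j) iJ jJ ij.
    by apply/orP; left; move: h; rewrite intrB; lra.
  by apply/orP; right; move: h; rewrite intrB; lra.
Qed.

End DisjointArcs.

(** * Total variation of periodic functions *)

Section PeriodicVariation.
Context {R : realType}.
Local Notation TV := total_variation.

Lemma total_variation_shift_le (a c e : R) (f : R -> R) :
  (TV (a + e)%R (c + e)%R f <= TV a c (fun x => f (x + e)%R))%E.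
Proof.
apply: le_ereal_sup => _ [_ [s [ps ls] <-] <-].
pose g (x : R) := x - e; have ag : a = g (a + e) by rewrite /g addrK.
exists (variation a c (fun x => f (x + e)) (map g s)).
  apply: variations_variation; split; rewrite ag ?path_map ?last_map.
    by apply: sub_path ps => u z /=; rewrite /g ltrD2r.
  by rewrite (eqP ls) /g addrK.
congr EFin; rewrite /variation size_map; apply: eq_big_nat => i /andP[_ ilt].
have nE k : (k <= size s)%N ->
    nth c (a :: map g s) k + e = nth (c + e) (a + e :: s) k.
  by move=> ks; rewrite {1}ag -map_cons (nth_map (c + e)) // /g subrK.
by rewrite /= !(nE i.+1) ?(nE i) //; exact: ltnW.
Qed.

Variable f : R -> R.
Hypothesis f1 : forall x, f (x + 1) = f x.

Lemma total_variation_shift (a c : R) (b : int) : TV (a + b%:~R) (c + b%:~R) f = TV a c f.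
Proof.
have le u v (k : int) : (TV (u + k%:~R)%R (v + k%:~R)%R f <= TV u v f)%E.
  apply: le_trans (total_variation_shift_le _ _ _ _) _.
  by rewrite (_ : (fun x => _) = f) //; apply/funext => x; exact: periodic_int.
apply/eqP; rewrite eq_le le /=.
by have := le (a + b%:~R) (c + b%:~R) (- b); rewrite mulrNz !addrK.
Qed.

Lemma total_variation_circle (c : R) : TV c (c + 1) f = TV 0 1 f.
Proof.
pose n := Num.floor c; pose u := c - n%:~R.
have u0 : 0 <= u by rewrite subr_ge0 floor_le.
have u1 : u <= 1 by have := floorD1_gt c; rewrite intrD /u => ?; rewrite -/n; lra.
have -> : TV c (c + 1) f = TV u (u + 1) f.
  rewrite -(total_variation_shift u (u + 1) n).
  by congr (total_variation _ _ _); rewrite /u; ring.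
rewrite (@total_variationD _ u (u + 1) 1) ?lerDr // (@total_variationD _ 0 1 u) //.
by rewrite addeC; congr (_ + _)%E; have := total_variation_shift 0 u 1; rewrite add0r.
Qed.

Lemma sum_variation_arcs (I : eqType) (J : seq I) (x y : I -> R) : uniq J ->
  (forall i, i \in J -> x i <= y i <= x i + 1) ->
  (forall i j (b : int), i \in J -> j \in J -> i != j ->
     y i + b%:~R <= x j \/ y j <= x i + b%:~R) ->
  (\sum_(i <- J) (`|f (y i) - f (x i)|)%:E <= TV 0 1 f)%E.
Proof.
move=> uJ xy sep; have := @sum_separated_circle R (fun a b => TV a b f).
move=> /(_ _ _ (TV 0 1 f) _ _ I J x y uJ xy sep) h; apply: le_trans (h _ _ _ _).
- rewrite big_seq [leRHS]big_seq; apply: lee_sum => i iJ.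
  by apply: total_variation_ge; have /andP[] := xy i iJ.
- by move=> a b ab; exact: total_variation_ge0.
- by move=> a b c ab bc; rewrite [leRHS](total_variationD f ab bc).
- by move=> a c b; exact: total_variation_shift.
- by move=> c; rewrite total_variation_circle.
Qed.

End PeriodicVariation.

Lemma sum_length_arcs {R : realType} (I : eqType) (J : seq I) (x y : I -> R) : uniq J ->
  (forall i, i \in J -> x i <= y i <= x i + 1) ->
  (forall i j (b : int), i \in J -> j \in J -> i != j ->
     y i + b%:~R <= x j \/ y j <= x i + b%:~R) ->
  \sum_(i <- J) (y i - x i) <= 1.
Proof.
move=> uJ xy sep; rewrite -lee_fin -sumEFin.
apply: (@sum_separated_circle R (fun a b => (b - a)%:E)) => //.
- by move=> a b ab; rewrite lee_fin subr_ge0.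
- by move=> a b c _ _; rewrite -EFinD lee_fin; lra.
- by move=> a c b; congr EFin; ring.
- by move=> c; rewrite lee_fin; lra.
Qed.

(** * Means of continuous functions over a period *)

Section Mean.
Context {R : realType}.
Implicit Types f g : R -> R.
Local Notation leb := (@lebesgue_measure R).

Definition mean f : R := \int[leb]_(t in `[0, 1]) f t.

Lemma integrable_segment f (a b : R) : continuous f ->
  leb.-integrable `[a, b] (EFin \o f).
Proof.
move=> cf; apply: continuous_compact_integrable; first exact: segment_compact.
exact: continuous_subspaceT.
Qed.

Lemma meanD f g : continuous f -> continuous g ->
  mean (fun t => f t + g t) = mean f + mean g.
Proof. by move=> cf cg; rewrite /mean RintegralD //; exact: integrable_segment. Qed.

Lemma meanZ c f : continuous f -> mean (fun t => c * f t) = c * mean f.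
Proof. by move=> cf; rewrite /mean RintegralZl //; exact: integrable_segment. Qed.

Lemma mean_cst c : mean (fun=> c) = c.
Proof.
rewrite /mean Rintegral_cst //= lebesgue_measure_itv /= lte_fin ltr01 /=.
by rewrite oppr0 addr0 mulr1.
Qed.

Lemma mean_le f g : continuous f -> continuous g -> (forall t, f t <= g t) ->
  mean f <= mean g.
Proof.
by move=> cf cg fg; apply: le_Rintegral => //; exact: integrable_segment.
Qed.

Lemma sum_continuous (I : Type) (J : seq I) (f : I -> R -> R) :
  (forall i, continuous (f i)) -> continuous (fun t => \sum_(i <- J) f i t).
Proof.
move=> cf; elim: J => [|i J IH].
  rewrite (_ : (fun t => _) = fun=> 0); first exact: cst_continuous.
  by apply/funext => t; rewrite big_nil.
rewrite (_ : (fun t => _) = fun t => f i t + \sum_(j <- J) f j t).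
  by move=> t; apply: cvgD; [exact: cf|exact: IH].
by apply/funext => t; rewrite big_cons.
Qed.

Lemma mean_sum (I : Type) (J : seq I) (f : I -> R -> R) :
  (forall i, continuous (f i)) ->
  mean (fun t => \sum_(i <- J) f i t) = \sum_(i <- J) mean (f i).
Proof.
move=> cf; elim: J => [|i J IH].
  by rewrite big_nil -[RHS]mean_cst; congr mean; apply/funext => t; rewrite big_nil.
rewrite big_cons -IH -meanD //; last exact: sum_continuous.
by congr mean; apply/funext => t; rewrite big_cons.
Qed.

Lemma Rintegral_shift f (a b e : R) : a <= b -> continuous f ->
  \int[leb]_(t in `[a + e, b + e]) f t = \int[leb]_(t in `[a, b]) f (t + e).
Proof.
move=> ab cf; rewrite /Rintegral; congr fine.
have dF x : is_derive x (1 : R) (fun t => t + e) 1.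
  by apply: is_derive_eq; rewrite ?addr0.
have F1 : (fun t => t + e)^`() = cst 1.
  by apply/funext => x; rewrite derive1E derive_val.
have cF : continuous (fun t : R => t + e).
  by move=> x; apply: cvgD; [exact: cvg_id|exact: cvg_cst].
rewrite (integration_by_substitution_increasing (F := fun t => t + e) (G := f) ab) ?F1.
- by apply: eq_integral => x _ /=; rewrite mulr1.
- by move=> x y _ _ xy; rewrite ltrD2r.
- by move=> x _; exact: cst_continuous.
- exact: is_cvg_cst.
- exact: is_cvg_cst.
- split; first by move=> x _; exact: ex_derive.
  + by apply: cvg_at_right_filter; exact: cF.
  + by apply: cvg_at_left_filter; exact: cF.
- exact: continuous_subspaceT.
Qed.

(** Periodicity reduces the shift to [0 <= u <= 1]; then the piece over [[1, 1 + u]] replaces the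
    one over [[0, u]]. *)
Lemma mean_shift f (e : R) : continuous f -> (forall t, f (t + 1) = f t) ->
  mean (fun t => f (t + e)) = mean f.
Proof.
move=> cf f1; pose u := e - (Num.floor e)%:~R.
have u0 : 0 <= u by rewrite subr_ge0 floor_le.
have u1 : u <= 1.
  by have := floorD1_gt e; rewrite intrD /u => ?; lra.
have -> : (fun t => f (t + e)) = (fun t => f (t + u)).
  by apply/funext => t; rewrite -(periodic_int f1 (t + u) (Num.floor e)) /u -addrA subrK.
rewrite /mean -Rintegral_shift // add0r.
have i1 := integrable_segment u (1 + u) cf; have i2 := integrable_segment 0 1 cf.
have b1 : (BLeft u <= BRight (1 : R))%O by rewrite bnd_simp.
have b2 : (BRight (1 : R) <= BRight (1 + u))%O by rewrite bnd_simp lerDl.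
have b3 : (BLeft (0 : R) <= BRight u)%O by rewrite bnd_simp.
have b4 : (BRight u <= BRight (1 : R))%O by rewrite bnd_simp.
have := Rintegral_itvB i1 b1 b2; have := Rintegral_itvB i2 b3 b4.
have ioc (a b : R) : leb.-integrable `]a, b] (EFin \o f).
  by apply: integrableS (integrable_segment a b cf) => //; exact: subset_itv_oc_cc.
rewrite !(Rintegral_itv_obnd_cbnd (ioc _ _)).
have -> : \int[leb]_(x in `[1, (1 + u)]) f x = \int[leb]_(t in `[0, u]) f t.
  rewrite -[X in `[X, _]]add0r [1 + u]addrC Rintegral_shift //.
  by apply: eq_Rintegral => t _; rewrite f1.
by move=> ? ?; lra.
Qed.

(** A nonnegative integral is a supremum over simple functions below the integrand, so this applies
    to [fibre_var], whose measurability is not established. *)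
Lemma ge0_integral_mono (D : set R) (f g : R -> \bar R) :
  (forall x, D x -> 0 <= f x)%E -> (forall x, D x -> f x <= g x)%E ->
  (\int[leb]_(x in D) f x <= \int[leb]_(x in D) g x)%E.
Proof.
move=> f0 fg; rewrite !ge0_integralE //; last first.
  by move=> x Dx; apply: le_trans (f0 x Dx) (fg x Dx).
apply: le_ereal_sup => _ [h /= hf <-]; exists h => //= x.
apply: le_trans (hf x) _; rewrite !patchE; case: ifPn => //.
by rewrite inE => /fg.
Qed.

Lemma mean_le_integral f (g : R -> \bar R) : continuous f -> (forall t, 0 <= f t) ->
  (forall t, ((f t)%:E <= g t)%E) ->
  ((mean f)%:E <= \int[leb]_(t in `[0%R, 1%R]) g t)%E.
Proof.
move=> cf f0 fg; rewrite /mean /Rintegral fineK.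
  by apply: ge0_integral_mono => // x _; rewrite lee_fin.
exact: (integrable_fin_num _ (integrable_segment 0 1 cf)).
Qed.

End Mean.

(** * Closest returns *)

Section Kernel.
Context {R : realType}.
Variables w rho s : R.
Hypothesis wi : irrational w.
Hypothesis ind : ~ rationally_related w rho.

(* Level gained, relative to a line of slope s, by the n-th iterate followed by the deck translation by (-a, -b). *)
Definition lev (n a b : int) : R := n%:~R * rho - b%:~R - s * (n%:~R * w - a%:~R).

Lemma levN n a b : lev (- n) (- a) (- b) = - lev n a b.
Proof. by rewrite /lev !mulrNz; ring. Qed.

(** If two kernel vectors had non-proportional [(n, a)], then [s] would be rational and [w], [rho],
    1 would be related. So all are proportional to one [(n1, a1)], and [|n w - a|] is at least
    [|n1 w - a1| / |n1|], which is the [2 * e] of the proof. *)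
Lemma lev_kernel (d : R) : 0 < d -> exists e, [/\ 0 < e, e <= d &
  forall n a b : int, n != 0 -> `|n%:~R * w - a%:~R| < 2 * e -> lev n a b != 0].
Proof.
move=> d0; have [[n1 [a1 [b1 [n10 k1]]]]|nk] :=
  pselect (exists n a b : int, n != 0 /\ lev n a b = 0); last first.
  exists d; split => // n a b n0 _; apply/eqP => k.
  by apply: nk; exists n, a, b.
have n1R : (n1%:~R : R) != 0 by rewrite intr_eq0.
have b10 : 0 < `|n1%:~R * w - a1%:~R|.
  rewrite normr_gt0; apply/eqP => /eqP; rewrite subr_eq0 => /eqP.
  by move=> /(irrational_int wi)[n0' _]; rewrite n0' in n10.
pose e := `|n1%:~R * w - a1%:~R| / (2 * `|n1%:~R|).
have n1p : 0 < `|n1%:~R : R| by rewrite normr_gt0.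
have e0 : 0 < e by rewrite divr_gt0 // mulr_gt0.
exists (Num.min d e); split; [by rewrite lt_min d0|by rewrite ge_min lexx|].
move=> n a b n0 lt; apply/eqP => k.
have {}lt : `|n%:~R * w - a%:~R| < 2 * e.
  by apply: lt_le_trans lt _; rewrite ler_pM2l // ge_min lexx orbT.
have [A0|A0] := eqVneq (n1 * a - n * a1) 0.
  have E : n1%:~R * (n%:~R * w - a%:~R) = n%:~R * (n1%:~R * w - a1%:~R) :> R.
    have : (n1 * a)%:~R = (n * a1)%:~R :> R by congr (_%:~R); apply/eqP; rewrite -subr_eq0 A0.
    by rewrite !intrM => ?; lra.
  move: lt; rewrite -(ltr_pM2l n1p) -normrM E normrM ltNge => /negP; apply.
  have -> : `|n1%:~R| * (2 * e) = 1 * `|n1%:~R * w - a1%:~R|.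
    by rewrite /e; field; rewrite gt_eqF.
  by rewrite ler_pM2r // norm_intr_ge1 //; rewrite ?intr_int // intr_eq0.
apply: ind; exists (- (n1 * (n1 * b - n * b1))), (n1 * (n1 * a - n * a1)),
  (a1 * (n1 * b - n * b1) - (n1 * a - n * a1) * b1).
split; first by rewrite mulf_neq0.
have k2 : s * (n1 * a - n * a1)%:~R = (n1 * b - n * b1)%:~R.
  move: k k1; rewrite /lev !intrB !intrM => k k1.
  have : n1%:~R * (n%:~R * rho - b%:~R - s * (n%:~R * w - a%:~R))
     - n%:~R * (n1%:~R * rho - b1%:~R - s * (n1%:~R * w - a1%:~R)) = 0.
    by rewrite k k1; ring.
  by move=> ?; lra.
move: k2 k1; rewrite /lev; move: (n1 * a - n * a1) (n1 * b - n * b1) => A B k2 k1.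
have k3 : A%:~R * (n1%:~R * rho - b1%:~R - s * (n1%:~R * w - a1%:~R)) = 0.
  by rewrite k1 mulr0.
have k4 : (s * A%:~R - B%:~R) * (n1%:~R * w - a1%:~R) = 0 by rewrite k2 subrr mul0r.
by rewrite mulrNz intrB !intrM; lra.
Qed.

(** For each [n] at most one [a] is admissible, as [e <= 1/4], and the levels are then [y - b] with
    [y] not an integer. The gap is a minimum over finitely many [n]. *)
Lemma lev_gap (e : R) : e <= 4^-1 ->
  (forall n a b : int, n != 0 -> `|n%:~R * w - a%:~R| < 2 * e -> lev n a b != 0) ->
  forall N : nat, exists2 g : R, 0 < g & forall n a b : int,
    n != 0 -> `|n| <= N%:Z -> `|n%:~R * w - a%:~R| < e -> g <= `|lev n a b|.
Proof.
move=> e4 ker.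
have one (n : int) : n != 0 -> exists2 g : R, 0 < g & forall a b : int,
    `|n%:~R * w - a%:~R| < e -> g <= `|lev n a b|.
  move=> n0; have [[a1 ha1]|na] :=
    pselect (exists a : int, `|n%:~R * w - a%:~R| < e); last first.
    by exists 1 => // a b ha; exfalso; apply: na; exists a.
  pose y := n%:~R * rho - s * (n%:~R * w - a1%:~R).
  have ly b : lev n a1 b = y - b%:~R by rewrite /lev /y; ring.
  have e0 : 0 < e by apply: le_lt_trans ha1.
  have y1 : 0 < y - (Num.floor y)%:~R.
    rewrite lt_neqAle subr_ge0 floor_le andbT eq_sym -ly.
    by apply: ker => //; apply: lt_trans ha1 _; lra.
  have y2 : 0 < (Num.floor y + 1)%:~R - y by rewrite subr_gt0 floorD1_gt.
  exists (Num.min (y - (Num.floor y)%:~R) ((Num.floor y + 1)%:~R - y)).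
    by rewrite lt_min y1.
  move=> a b ha; have -> : a = a1.
    have : `|(a - a1)%:~R| < 1 :> R.
      move: ha ha1; rewrite intrB !ltr_norml => /andP[? ?] /andP[? ?].
      by apply/andP; split; lra.
    by rewrite -intr_norm ltrz1 => ?; lia.
  rewrite ly ge_min; have [le|lt] := leP b (Num.floor y).
    apply/orP; left; apply: le_trans (ler_norm _); rewrite lerD2l lerN2.
    by rewrite ler_int.
  apply/orP; right; rewrite distrC; apply: le_trans (ler_norm _); rewrite lerD2r.
  by rewrite ler_int; lia.
elim=> [|N [g g0 hg]].
  by exists 1 => // n a b n0 nN; exfalso; move/eqP: n0; lia.
have [g1 g10 h1] := one N.+1%:Z isT.
exists (Num.min g g1); first by rewrite lt_min g0.
move=> n a b n0 nN ha; rewrite ge_min.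
have [nN'|nN'] := leP `|n| N%:Z; first by rewrite hg.
have [nE|nE] : n = N.+1%:Z \/ n = - N.+1%:Z by lia.
  by rewrite nE h1 ?orbT // -nE.
apply/orP; right; rewrite nE -normrN -levN opprK; apply: h1.
by rewrite -normrN; move: ha; rewrite nE !mulrNz; congr (`| _ | < _); ring.
Qed.

(** Times [m] of both signs compete, because differences of two times below [n] will be inserted.
    The bound [2^-1] keeps arcs of this level difference shorter than one turn. *)
Definition closest_return (e : R) (n : nat) (a b : int) := [/\ (0 < n)%N,
  `|n%:R * w - a%:~R| < e, `|lev n a b| < 2^-1 &
  forall m c d : int, m != 0 -> `|m| < n%:Z -> `|m%:~R * w - c%:~R| < e ->
    `|lev n a b| < `|lev m c d| ].

(** The least time whose level is below the gap of all times up to [N] exceeds [N], and its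
    minimality makes it a closest return. *)
Lemma closest_returns (e : R) : 0 < e -> e <= 4^-1 ->
  (forall n a b : int, n != 0 -> `|n%:~R * w - a%:~R| < 2 * e -> lev n a b != 0) ->
  forall N : nat, exists n a b, (N < n)%N /\ closest_return e n a b.
Proof.
move=> e0 e4 ker N; have [g g0 hg] := lev_gap e4 ker N.
pose g' := Num.min g 2^-1; have g'0 : 0 < g' by rewrite lt_min g0 invr_gt0 ltr0n.
pose P (n : nat) := `[< (0 < n)%N /\ exists a b : int,
  `|n%:R * w - a%:~R| < e /\ `|lev n a b| < g' >].
have exP : exists n, P n.
  have s1 : 0 < 1 + `|s| by rewrite ltr_pwDl.
  have e1 : 0 < Num.min e (g' / (1 + `|s|)) by rewrite lt_min e0 divr_gt0.
  have [n [a [b [n0]]]] := dirichlet2 w rho e1.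
  rewrite !lt_min => /andP[ha ha'] /andP[_ hb].
  exists `|n|%N; apply/asboolP; split; first by rewrite absz_gt0 gt_eqF.
  have nE : `|n|%N%:Z = n by rewrite gez0_abs // ltW.
  exists a, b; rewrite pmulrn nE; split => //.
  apply: le_lt_trans (ler_normB _ _) _; rewrite normrM.
  have -> : g' = g' / (1 + `|s|) + `|s| * (g' / (1 + `|s|)).
    by field; rewrite gt_eqF.
  by rewrite ltr_leD // ler_wpM2l // ltW.
case: (ex_minnP exP) => n /asboolP[n0 [a [b [ha hl]]]] nmin.
exists n, a, b; have g1 : `|lev n a b| < g by apply: lt_le_trans hl _; rewrite ge_min lexx.
split.
  rewrite ltnNge; apply/negP => nN.
  have := hg n a b; rewrite -pmulrn => /(_ _ _ ha) h.
  have : g <= `|lev n a b| by apply: h; [rewrite -lt0n|rewrite lez_nat].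
  by rewrite leNgt g1.
split => //; first by apply: lt_le_trans hl _; rewrite ge_min lexx orbT.
move=> m c d m0 mn hc; apply: lt_le_trans hl _; rewrite leNgt; apply/negP => lt.
have mE : (m = `|m|%N%:Z) \/ (m = - `|m|%N%:Z) by lia.
have mp : (0 < `|m|)%N by rewrite absz_gt0.
suff /nmin : P `|m|%N by move=> ?; lia.
apply/asboolP; split => //; case: mE => mE.
  by exists c, d; rewrite pmulrn -mE.
exists (- c), (- d); have {}mE : `|m|%N%:Z = - m by rewrite [in RHS]mE opprK.
rewrite pmulrn mE levN normrN; split => //.
by rewrite -normrN; move: hc; rewrite !mulrNz; congr (`| _ | < _); ring.
Qed.

End Kernel.

(** * A continuous periodic bump function *)

Section Bump.
Context {R : realType}.
Implicit Types t z : R.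

(** Half the positive part of [y]: a 1-periodic function with values in [[0, 1]], supported where
    [t] is within [e / 2] of [z] modulo 1. *)
Definition cos_bump (z e t : R) : R :=
  let y := cos (pi *+ 2 * (t - z)) - cos (pi * e) in (y + `|y|) / 4.

Lemma cos_bump_cont z e : continuous (cos_bump z e).
Proof.
have c1 : continuous (fun t : R => cos (pi *+ 2 * (t - z)) - cos (pi * e)).
  move=> t; apply: cvgB; last exact: cvg_cst.
  apply: (@continuous_comp _ _ _ (fun t : R => pi *+ 2 * (t - z)) (@cos R)).
    by apply: cvgM; [exact: cvg_cst|apply: cvgB; [exact: cvg_id|exact: cvg_cst]].
  exact: continuous_cos.
move=> t; apply: cvgM; last exact: cvg_cst.
by apply: cvgD; [exact: c1|apply: cvg_norm; exact: c1].
Qed.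

Lemma cos_bump_per z e t : cos_bump z e (t + 1) = cos_bump z e t.
Proof.
rewrite /cos_bump (_ : pi *+ 2 * (t + 1 - z) = pi *+ 2 * (t - z) + pi *+ 2).
  by rewrite cosD2pi.
by ring.
Qed.

Lemma cos_bump_ge0 z e t : 0 <= cos_bump z e t.
Proof.
rewrite /cos_bump /=; set y := _ - _; rewrite divr_ge0 //.
by have := ler_norm (- y); rewrite normrN; lra.
Qed.

Lemma cos_bump_le1 z e t : cos_bump z e t <= 1.
Proof.
rewrite /cos_bump /=; set y := _ - _; have : `|y| <= 2.
  have := cos_max (pi *+ 2 * (t - z)); have := cos_max (pi * e).
  by rewrite /y !ler_norml => /andP[? ?] /andP[? ?]; apply/andP; split; lra.
by have := ler_norm y; lra.
Qed.

Lemma cos_near_int t : exists2 a : int, `|t - a%:~R| <= 2^-1 &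
  cos (pi *+ 2 * t) = cos (pi *+ 2 * `|t - a%:~R|).
Proof.
exists (Num.floor (t + 2^-1)).
  have := floor_le (t + 2^-1); have := floorD1_gt (t + 2^-1); rewrite intrD => ? ?.
  by rewrite ler_norml; apply/andP; split; lra.
set a := Num.floor _; have p1 u : cos (pi *+ 2 * (u + 1)) = cos (pi *+ 2 * u) :> R.
  by rewrite mulrDr mulr1 cosD2pi.
have pp : 0 <= pi *+ 2 :> R by rewrite mulrn_wge0 // pi_ge0.
rewrite -[X in X * `|_|](ger0_norm pp) -normrM cos_norm.
by have := periodic_int p1 t (- a); rewrite mulrNz => ->.
Qed.

Lemma cos_bump_supp z e t : 0 <= e <= 1 -> cos_bump z e t != 0 ->
  exists a : int, `|t - a%:~R - z| < e / 2.
Proof.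
move=> window_le1; have [a ha ca] := cos_near_int (t - z).
rewrite /cos_bump ca => y0; exists a; rewrite (_ : t - a%:~R - z = t - z - a%:~R); last by ring.
have pi0 := pi_gt0 R.
have : 0 < cos (pi *+ 2 * `|t - z - a%:~R|) - cos (pi * e).
  rewrite ltNge; apply/negP => h; move: y0.
  by rewrite /= (ler0_norm h) subrr mul0r eqxx.
rewrite subr_gt0 ltr_cos.
- by rewrite -mulr_natl => h; rewrite -(ltr_pM2l pi0); lra.
- by rewrite in_itv /= ?(mulr2n pi); have := normr_ge0 (t - z - a%:~R); case/andP: window_le1 => ? ? ?; apply/andP; split; nra.
- by rewrite in_itv /= ?(mulr2n pi); have := normr_ge0 (t - z - a%:~R); case/andP: window_le1 => ? ? ?; apply/andP; split; nra.
Qed.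

Lemma cos_bump_lower z e : 0 < e <= 1 -> exists2 y : R, 0 < y & forall t (a : int),
  `|t - a%:~R - z| < e / 4 -> y <= cos_bump z e t.
Proof.
move=> /andP[e0 e1]; have pi0 := pi_gt0 R.
pose y : R := cos (pi * (e / 2)) - cos (pi * e).
have y0 : 0 < y.
  rewrite subr_gt0 ltr_cos; first by rewrite ltr_pM2l //; lra.
  - by rewrite in_itv /=; apply/andP; split; nra.
  - by rewrite in_itv /=; apply/andP; split; nra.
exists (y / 2) => [|t a ha]; first by rewrite divr_gt0.
have p1 u : cos (pi *+ 2 * (u + 1)) = cos (pi *+ 2 * u) :> R.
  by rewrite mulrDr mulr1 cosD2pi.
have pp : 0 <= pi *+ 2 :> R by rewrite mulrn_wge0 // ltW.
have ca : cos (pi *+ 2 * (t - z)) = cos (pi *+ 2 * `|t - a%:~R - z|).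
  rewrite -[X in X * `|_|](ger0_norm pp) -normrM cos_norm.
  have := periodic_int p1 (t - z) (- a); rewrite mulrNz => <-.
  by congr cos; ring.
rewrite /cos_bump ca; set v := `|_| in ha *.
have v0 : 0 <= v by exact: normr_ge0.
have : cos (pi * (e / 2)) <= cos (pi *+ 2 * v).
  rewrite leNgt ltr_cos -?leNgt.
  - by rewrite -mulr_natl; nra.
  - by rewrite in_itv /= -mulr_natl; apply/andP; split; nra.
  - by rewrite in_itv /=; apply/andP; split; nra.
move=> h /=; set q := _ - cos _; have : y <= q by rewrite /y /q; lra.
by have := ler_norm q; lra.
Qed.

(** Finitely many rotated copies add up to at least [y > 0] everywhere, and all of them have the
    same mean. *)
Lemma cos_bump_mean_gt0 z e (w : R) : irrational w -> 0 < e <= 1 -> 0 < mean (cos_bump z e).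
Proof.
move=> wi window_le1; have [y y0 hy] := cos_bump_lower z window_le1.
have e40 : 0 < e / 4 by rewrite divr_gt0 //; case/andP: window_le1.
have [N hN] := dense_rotation_bounded wi e40.
pose f (j : nat) t := cos_bump z e (t + j%:R * w).
have cf j : continuous (f j).
  move=> t; apply: (@continuous_comp _ _ _ (fun t => t + j%:R * w) (cos_bump z e)).
    by apply: cvgD; [exact: cvg_id|exact: cvg_cst].
  exact: cos_bump_cont.
have : y <= mean (fun t => \sum_(j <- iota 0 N.+1) f j t).
  rewrite -[leLHS]mean_cst; apply: mean_le; [exact: cst_continuous|exact: sum_continuous|].
  move=> t; have [j [a [jN ja]]] := hN (t - z).
  rewrite (big_rem j); last by rewrite mem_iota add0n ltnS.
  rewrite /=.
  apply: le_trans (_ : f j t <= _); last by rewrite lerDl sumr_ge0 // => i _; exact: cos_bump_ge0.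
  apply: (hy _ a); rewrite (_ : _ - z = t - z + j%:R * w - a%:~R) //; ring.
rewrite mean_sum //.
rewrite (eq_bigr (fun=> mean (cos_bump z e))); last first.
  by move=> j _; rewrite /f mean_shift //; [exact: cos_bump_cont|exact: cos_bump_per].
rewrite big_const_seq count_predT size_iota iter_addr addr0 => h.
by have := lt_le_trans y0 h; rewrite pmulrn_lgt0.
Qed.

End Bump.

(** * The Denjoy argument *)

Section Denjoy.
Context {R : realType}.
Variables (w : R) (F : R -> R -> R).
Hypothesis hF : fibre_homeo F.
Hypothesis wi : irrational w.
Hypothesis dF : forall t x, derivable (F t) x 1.
Hypothesis dF0 : forall t x, 0 < derive1 (F t) x.
Hypothesis bv : (\int[@lebesgue_measure R]_(t in `[0%R, 1%R]) fibre_var F t < +oo)%E.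
Variables (rho M : R) (h : R -> R -> R).
Hypothesis hs : semiconj w F rho M h.
Variables t0 r1 s c x1 x2 : R.
Hypothesis r10 : 0 < r1.
Hypothesis x12 : x1 < x2.
Hypothesis hbox : forall t x, `|t - t0| <= r1 -> x1 <= x <= x2 -> h t x = s * (t - t0) + c.
Local Notation Ph := (Phi w F).
Local Notation lv := (lev w rho s).

Definition len (n : int) t := Ph n t x2 - Ph n t x1.

Lemma len_gt0 n t : 0 < len n t.
Proof. by rewrite subr_gt0 Phi_lt. Qed.

Lemma len_cont n : continuous (len n).
Proof. by move=> t; apply: cvgB; exact: Phi_cont_base. Qed.

Lemma len_per n t : len n (t + 1) = len n t.
Proof. by rewrite /len !(Phi_per w hF n t 1). Qed.

Lemma ln_len_cont n : continuous (fun t => ln (len n t)).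
Proof.
move=> t; apply: (@continuous_comp _ _ _ (len n) (@ln R)); first exact: len_cont.
by apply: continuous_ln; exact: len_gt0.
Qed.

(* The integer a brings t back into the base of the box. *)
Lemma level_image (n a : int) t x : `|t - a%:~R - t0| <= r1 -> Ph n t x1 <= x <= Ph n t x2 ->
  h (t + n%:~R * w) x = s * (t - a%:~R - t0) + c + n%:~R * rho.
Proof.
move=> ht /andP[le1 le2].
have E y : x1 <= y <= x2 -> h (t + n%:~R * w) (Ph n t y) = s * (t - a%:~R - t0) + c + n%:~R * rho.
  move=> hy; rewrite (semiconj_iter hs); congr (_ + _).
  by rewrite -(semiconj_per hs t y (- a)) mulrNz hbox.
apply/eqP; rewrite eq_le; apply/andP; split.
  by rewrite -(E x2) ?lexx ?(ltW x12) //; exact: (semiconj_mono hs).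
by rewrite -(E x1) ?lexx ?(ltW x12) //; exact: (semiconj_mono hs).
Qed.

(** The levels on arc [i] fill at most an interval of length [|g|] with [L i] at one end. These
    intervals are disjoint modulo 1, and monotonicity of [h] carries their order over to the arcs.
    [Num.min] and [Num.max] appear because [g] may have either sign. *)
Lemma level_arcs_separated (I : eqType) (J : seq I) (t g : R) (p q L : I -> R) : `|g| < 1 ->
  (forall i, i \in J -> h t (p i) = L i /\ h t (q i) = L i + g) ->
  (forall i j (b : int), i \in J -> j \in J -> i != j -> `|g| < `|L i - L j + b%:~R|) ->
  (forall i, i \in J -> Num.min (p i) (q i) <= Num.max (p i) (q i) <= Num.min (p i) (q i) + 1) /\
  (forall i j (b : int), i \in J -> j \in J -> i != j ->
    Num.max (p i) (q i) + b%:~R <= Num.min (p j) (q j) \/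
    Num.max (p j) (q j) <= Num.min (p i) (q i) + b%:~R).
Proof.
move=> g1 lv sep.
have lmin i : i \in J -> L i + Num.min 0 g <= h t (Num.min (p i) (q i)).
  move=> /lv[hp hq]; have m0 : Num.min 0 g <= 0 by rewrite ge_min lexx.
  have mg : Num.min 0 g <= g by rewrite ge_min lexx orbT.
  by case: (leP (p i) (q i)) => _; rewrite ?hp ?hq; lra.
have lmax i : i \in J -> h t (Num.max (p i) (q i)) <= L i + Num.max 0 g.
  move=> /lv[hp hq]; have m0 : 0 <= Num.max 0 g by rewrite le_max lexx.
  have mg : g <= Num.max 0 g by rewrite le_max lexx orbT.
  by case: (leP (p i) (q i)) => _; rewrite ?hp ?hq; lra.
have gE : Num.max 0 g - Num.min 0 g = `|g|.
  by case: (ltP 0 g) => g0; [rewrite gtr0_norm // subr0|rewrite ler0_norm // sub0r].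
have lt x y : h t x < h t y -> x < y by exact: (semiconj_lt hs).
split.
  move=> i iJ.
  have -> : Num.min (p i) (q i) <= Num.max (p i) (q i) by rewrite ge_min !le_max lexx.
  have [//|mm] := leP (Num.max (p i) (q i)) (Num.min (p i) (q i) + 1).
  have := semiconj_mono hs t (ltW mm); rewrite (semiconj_deg hs t _ 1).
  by have := lmin i iJ; have := lmax i iJ => ? ? ?; lra.
move=> i j b iJ jJ ij; have := sep i j b iJ jJ ij.
have := lmin i iJ; have := lmax i iJ; have := lmin j jJ; have := lmax j jJ.
move=> ? ? ? ?; rewrite ltr_normr => /orP[k|k]; [right|left]; apply/ltW/lt;
  rewrite (semiconj_deg hs); lra.
Qed.

Variable e : R.
Hypothesis e0 : 0 < e.
Hypothesis e4 : e <= 4^-1.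
Hypothesis er : 2 * e <= r1.
Hypothesis ker : forall n a b : int, n != 0 -> `|n%:~R * w - a%:~R| < 2 * e -> lv n a b != 0.
Local Notation chi := (cos_bump t0 e).

Lemma window_le1 : 0 <= e <= 1.
Proof. by rewrite ltW // (le_trans e4) // invf_le1 // ler1n. Qed.

Lemma chi_supp (t : R) : chi t != 0 -> exists a : int, `|t - a%:~R - t0| < e / 2.
Proof. exact: (cos_bump_supp window_le1). Qed.

Lemma norm_half_base (t : R) : `|t| < e / 2 -> `|t| <= r1.
Proof. by move=> ht; apply/ltW/(lt_le_trans ht); have := e0; have := er; lra. Qed.

Lemma norm_double_base (t : R) : `|t| < 2 * e -> `|t| <= r1.
Proof. by move=> ht; apply/ltW/(lt_le_trans ht). Qed.

Lemma step_derivative (n : int) t : exists2 x, Ph n t x1 <= x <= Ph n t x2 &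
  ln (len (n + 1) t) - ln (len n t) = ln (derive1 (F (t + n%:~R * w)) x).
Proof.
have lt : Ph n t x1 < Ph n t x2 by rewrite Phi_lt.
set u := t + n%:~R * w.
have der x : x \in `](Ph n t x1), (Ph n t x2)[%R ->
    is_derive x 1 (F u) (derive1 (F u) x).
  by move=> _; rewrite derive1E; apply: DeriveDef.
have cont : {within `[Ph n t x1, Ph n t x2], continuous (F u)}.
  by apply: continuous_subspaceT; exact: (continuous_slice (fibre_cont hF)).
have [x] := MVT lt der cont.
rewrite in_itv /= => /andP[/ltW l1 /ltW l2] E; exists x; first by rewrite l1.
have -> : len (n + 1) t = derive1 (F u) x * len n t.
  by rewrite /len !PhiS // -/u E.
by rewrite lnM ?posrE ?len_gt0 // addrK.
Qed.

Definition log_ratio (n : int) t := ln (len (n + 1) t) - ln (len n t).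

Lemma log_ratio_cont n : continuous (log_ratio n).
Proof. by move=> t; apply: cvgB; exact: ln_len_cont. Qed.

Lemma shift_cont (f : R -> R) (d : R) : continuous f -> continuous (fun t => f (t + d)).
Proof.
move=> cf t; apply: (@continuous_comp _ _ _ (fun t => t + d) f); last exact: cf.
by apply: cvgD; [exact: cvg_id|exact: cvg_cst].
Qed.

(** Compares the [j]-th image of the segment over [t] with the [(j - n)]-th image of the segment
    over [t + n w]; both lie over [t + j w]. The weight restricts [t] to the base of the box. *)
Definition weighted_gap (n : nat) (j : nat) t :=
  chi t * `|log_ratio j%:Z t - log_ratio (j%:Z - n%:Z) (t + n%:R * w)|.

Lemma weighted_gap_cont n j : continuous (weighted_gap n j).
Proof.
move=> t; apply: cvgM; first exact: cos_bump_cont.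
apply: cvg_norm; apply: cvgB; first exact: log_ratio_cont.
by apply: shift_cont; exact: log_ratio_cont.
Qed.

Lemma weighted_gap_per n j t : weighted_gap n j (t + 1) = weighted_gap n j t.
Proof.
rewrite /weighted_gap cos_bump_per /log_ratio !len_per.
by rewrite (_ : t + 1 + n%:R * w = t + n%:R * w + 1) ?len_per //; ring.
Qed.

Lemma derivative_per t (z : R) : derive1 (F t) (z + 1) = derive1 (F t) z.
Proof.
rewrite /derive1.
rewrite (_ : (fun k => k^-1 *: (F t (k + (z + 1)) - F t (z + 1)))
           = (fun k => k^-1 *: (F t (k + z) - F t z))) //.
by apply/funext => k; rewrite addrA !(fibre_deg hF); congr (_ *: _); ring.
Qed.

Section Record.
Variables (n : nat) (a0 b0 : int).
Hypothesis cr : closest_return w rho s e n a0 b0.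
Local Notation g := (lv n a0 b0).

(** The two mean value points for index [j] have levels [L j] and [L j - g]. Since [L i - L j] is,
    up to an integer, a level at time [i - j], the closest return property separates the arcs
    joining these pairs, and the differences of [phi] over them add up to at most its variation. *)
Lemma weighted_gap_sum_le t :
  (((\sum_(0 <= j < n) weighted_gap n j (t - j%:R * w))%:E) <= fibre_var F t)%E.
Proof.
have [n0 ha g2 gmin] := cr.
pose phi x := ln (derive1 (F t) x).
have choose_pt (j : nat) : exists pqa : (R * R * int), chi (t - j%:R * w) != 0 ->
    [/\ `|t - j%:R * w - pqa.2%:~R - t0| < e / 2,
        weighted_gap n j (t - j%:R * w) <= `|phi pqa.1.2 - phi pqa.1.1|,
        h t pqa.1.1 = s * (t - j%:R * w - pqa.2%:~R - t0) + c + j%:R * rho &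
        h t pqa.1.2 = s * (t - j%:R * w - pqa.2%:~R - t0) + c + j%:R * rho - g ].
  have [z|nz] := boolP (chi (t - j%:R * w) == 0); first by exists (0, 0, 0).
  have [a hA] := chi_supp nz; set u := t - j%:R * w.
  have [x hx Ex] := step_derivative j%:Z u.
  have [y hy Ey] := step_derivative (j%:Z - n%:Z) (u + n%:R * w).
  have Eu : u + j%:Z%:~R * w = t by rewrite -pmulrn /u subrK.
  have Ev : u + n%:R * w + (j%:Z - n%:Z)%:~R * w = t.
    by rewrite intrB -!pmulrn /u; ring.
  rewrite Eu in Ex; rewrite Ev in Ey.
  have derper (z : R) (k : int) : derive1 (F t) (z + k%:~R) = derive1 (F t) z.
    exact: (periodic_int (derivative_per t)).
  (* The translation by [b0] turns the level difference into exactly [g], instead of [g] modulo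
     1. *)
  exists (x, y + b0%:~R, a) => _; split => /=.
  - exact: hA.
  - rewrite /weighted_gap -/u /log_ratio Ex Ey /phi derper.
    by rewrite distrC ler_piMl // cos_bump_le1.
  - rewrite -{1}Eu (level_image (norm_half_base hA) hx) -pmulrn //.
  (* The base point after the closest return is within [e / 2 + e] of [t0], still in the box. *)
  - have hA' : `|u + n%:R * w - (a + a0)%:~R - t0| <= r1.
      apply: norm_double_base; rewrite (_ : _ - t0 = (u - a%:~R - t0) + (n%:R * w - a0%:~R)).
        by apply: le_lt_trans (ler_normD _ _) _; move: hA ha; rewrite -/u => hA ha; have := e0; lra.
      by rewrite intrD; ring.
    rewrite (semiconj_deg hs) -{1}Ev (level_image hA' hy) /lev.
    by rewrite intrD intrB -!pmulrn /u; ring.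
have [pqa hpqa] := choice choose_pt.
pose J := [seq j <- index_iota 0 n | chi (t - j%:R * w) != 0].
have memJ j : j \in J -> (j < n)%N /\ chi (t - j%:R * w) != 0.
  by rewrite mem_filter mem_index_iota => /andP[-> /andP[_ ->]].
have uJ : uniq J by rewrite filter_uniq // iota_uniq.
pose p j := (pqa j).1.1; pose q j := (pqa j).1.2; pose a j := (pqa j).2.
pose L (j : nat) := s * (t - j%:R * w - (a j)%:~R - t0) + c + j%:R * rho.
have lv i : i \in J -> h t (p i) = L i /\ h t (q i) = L i + - g.
  by move=> /memJ[_ /hpqa[]].
have sep i j (b : int) : i \in J -> j \in J -> i != j -> `|- g| < `|L i - L j + b%:~R|.
  move=> /memJ[iN /hpqa[hi _ _ _]] /memJ[jN /hpqa[hj _ _ _]] ij; rewrite normrN.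
  have -> : L i - L j + b%:~R = lev w rho s (i%:Z - j%:Z) (a j - a i) (- b).
    by rewrite /lev /L !intrB mulrNz -!pmulrn; ring.
  apply: gmin; [by rewrite subr_eq0|lia|].
  have -> : (i%:Z - j%:Z)%:~R * w - (a j - a i)%:~R =
    (t - j%:R * w - (a j)%:~R - t0) - (t - i%:R * w - (a i)%:~R - t0).
    by rewrite !intrB -!pmulrn; ring.
  by apply: le_lt_trans (ler_normB _ _) _; rewrite /a; lra.
have g1 : `|- g| < 1 by rewrite normrN; lra.
have [arc1 arc2] := level_arcs_separated g1 lv sep.
have phi1 x : phi (x + 1) = phi x by rewrite /phi derivative_per.
rewrite (bigID (fun j => chi (t - j%:R * w) != 0)) /= [X in (_ + X)]big1 ?addr0; last first.
  by move=> j /negPn/eqP z; rewrite /weighted_gap z mul0r.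
rewrite -big_filter -/J.
apply: le_trans (sum_variation_arcs phi1 uJ arc1 arc2); rewrite sumEFin lee_fin.
rewrite big_seq [leRHS]big_seq; apply: ler_sum => j /memJ[_ /hpqa[_ + _ _]].
rewrite -/(p j) -/(q j) => /le_trans; apply.
by case: (leP (p j) (q j)) => // _; rewrite distrC.
Qed.

(* Summed over j, the j-th logarithmic ratio is taken back to the base by the shift j w; the n pairs of mean value points then bound disjoint arcs of one fibre. *)
Lemma record_lower : - fine (\int[@lebesgue_measure R]_(t in `[0%R, 1%R]) fibre_var F t)%E <=
  mean (fun t => chi t * (ln (len n%:Z t) + ln (len (- n%:Z) (t + n%:R * w)) - 2 * ln (x2 - x1))).
Proof.
pose f t := chi t * (ln (len n%:Z t) + ln (len (- n%:Z) (t + n%:R * w)) - 2 * ln (x2 - x1)).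
rewrite -[leRHS]/(mean f).
have cf : continuous f.
  move=> t; apply: cvgM; first exact: cos_bump_cont.
  apply: cvgB; last exact: cvg_cst.
  apply: cvgD; first exact: ln_len_cont.
  by apply: (shift_cont (f := fun t => ln (len (- n%:Z) t))); exact: ln_len_cont.
pose W t := \sum_(0 <= j < n) weighted_gap n j t.
pose W' t := \sum_(0 <= j < n) weighted_gap n j (t - j%:R * w).
have cw j : continuous (fun t => weighted_gap n j (t - j%:R * w)).
  by apply: shift_cont; exact: weighted_gap_cont.
have cW : continuous W by apply: sum_continuous => j; exact: weighted_gap_cont.
have cW' : continuous W' by apply: sum_continuous.
have fW t : - W t <= f t.
  have E : ln (len n%:Z t) + ln (len (- n%:Z) (t + n%:R * w)) - 2 * ln (x2 - x1) =
      \sum_(0 <= j < n) (log_ratio j%:Z t - log_ratio (j%:Z - n%:Z) (t + n%:R * w)).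
    (* The sum telescopes; each of the two terms of index 0 contributes [ln (x2 - x1)]. *)
    pose G (j : nat) := ln (len j%:Z t) - ln (len (j%:Z - n%:Z) (t + n%:R * w)).
    rewrite (eq_big_nat _ _ (F2 := fun j => G j.+1 - G j)); last first.
      move=> j _; rewrite /G /log_ratio -(addn1 j) PoszD (addrAC j%:Z 1); ring.
    by rewrite telescope_sumr // /G subrr sub0r /len !Phi0; ring.
  rewrite /f E mulr_sumr /W -sumrN; apply: ler_sum => j _; rewrite /weighted_gap -mulrN.
  rewrite ler_wpM2l ?cos_bump_ge0 // lerNl -normrN; exact: ler_norm.
have mW : mean W = mean W'.
  rewrite /W /W' mean_sum ?mean_sum //; last by move=> j; exact: weighted_gap_cont.
  apply: eq_bigr => j _; rewrite -(mean_shift (- (j%:R * w)) (@weighted_gap_cont n j)) //.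
  exact: weighted_gap_per.
have W0 t : 0 <= W' t.
  by apply: sumr_ge0 => j _; rewrite /weighted_gap mulr_ge0 // cos_bump_ge0.
have le := mean_le_integral cW' W0 weighted_gap_sum_le.
have le' : mean W' <= fine (\int[@lebesgue_measure R]_(t in `[0%R, 1%R]) fibre_var F t)%E.
  have fin : (\int[@lebesgue_measure R]_(t in `[0%R, 1%R]) fibre_var F t)%E \is a fin_num.
    rewrite ge0_fin_numE; first exact: bv.
    by apply: integral_ge0 => t _; exact: total_variation_ge0.
  by rewrite -lee_fin (fineK fin).
apply: le_trans (_ : - mean W <= _); first by rewrite lerN2 mW.
rewrite -mulN1r -meanZ //; apply: mean_le => //.
  by move=> t; apply: cvgM; [exact: cvg_cst|exact: cW].
by move=> t; rewrite mulN1r.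
Qed.

End Record.

(** Concavity: the right-hand side is the tangent of [ln] at [expR k]. *)
Lemma ln_le_tangent (k y : R) : 0 < y -> ln y <= y / expR k + k - 1.
Proof.
move=> y0; have p0 : 0 < y / expR k by rewrite divr_gt0 // expR_gt0.
have := @le_ln1Dx R (y / expR k - 1).
rewrite (_ : 1 + (_ - 1) = y / expR k); last by ring.
rewrite ltrBrDr addNr => /(_ p0).
by rewrite ln_div ?posrE ?expR_gt0 // expRK; lra.
Qed.

(** Turns the lower bound on the mean logarithms into one on the mean lengths, by integrating a
    tangent line of [ln] in place of Jensen's inequality. *)
Lemma record_mass : exists2 m : R, 0 < m & forall n a b, closest_return w rho s e n a b ->
  m <= mean (fun t => chi t * len n%:Z t)
     + mean (fun t => chi t * len (- n%:Z) (t + n%:R * w)).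
Proof.
set V := fine (\int[@lebesgue_measure R]_(t in `[0%R, 1%R]) fibre_var F t)%E.
pose X := mean chi; have X0 : 0 < X.
  by apply: (cos_bump_mean_gt0 _ wi); rewrite e0; case/andP: window_le1.
(* Chosen so that [K * X = - (V + 1) - 2 * X]; after the loss [V] of [record_lower], at least 1
   remains for [mean S / expR k]. *)
pose k := ln (x2 - x1) - (V + 1) / (2 * X).
exists (expR k) => [|n a b cr]; first exact: expR_gt0.
have c1 : continuous (fun t => chi t * len n%:Z t).
  by move=> t; apply: cvgM; [exact: cos_bump_cont|exact: len_cont].
have c2 : continuous (fun t => chi t * len (- n%:Z) (t + n%:R * w)).
  move=> t; apply: cvgM; first exact: cos_bump_cont.
  by apply: shift_cont; exact: len_cont.
have cc : continuous chi by exact: cos_bump_cont.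
pose S t := chi t * len n%:Z t + chi t * len (- n%:Z) (t + n%:R * w).
rewrite -meanD // -[leRHS]/(mean S).
have cS : continuous S by move=> t; apply: cvgD; [exact: c1|exact: c2].
pose K := 2 * k - 2 - 2 * ln (x2 - x1).
have up : mean (fun t => chi t * (ln (len n%:Z t) + ln (len (- n%:Z) (t + n%:R * w)) - 2 * ln (x2 - x1)))
    <= (expR k)^-1 * mean S + K * X.
  rewrite -!meanZ // -meanD; last 2 first.
  - by move=> t; apply: cvgM; [exact: cvg_cst|exact: cS].
  - by move=> t; apply: cvgM; [exact: cvg_cst|exact: cc].
  apply: mean_le.
  - move=> t; apply: cvgM; first exact: cos_bump_cont.
    apply: cvgB; last exact: cvg_cst.
    apply: cvgD; first exact: ln_len_cont.
    by apply: (shift_cont (f := fun t => ln (len (- n%:Z) t))); exact: ln_len_cont.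
  - by move=> t; apply: cvgD; (apply: cvgM; first exact: cvg_cst); [exact: cS|exact: cc].
  move=> t; rewrite (_ : _ + K * chi t = chi t *
    ((len n%:Z t / expR k + k - 1) + (len (- n%:Z) (t + n%:R * w) / expR k + k - 1)
      - 2 * ln (x2 - x1))); last by rewrite /S /K; ring.
  rewrite ler_wpM2l ?cos_bump_ge0 // lerD2r lerD // ln_le_tangent //; exact: len_gt0.
have lo := record_lower cr; rewrite -/V in lo.
have KX : K * X = - (V + 1) - 2 * X.
  by rewrite /K /k; field; rewrite gt_eqF.
have : 1 <= (expR k)^-1 * mean S by rewrite KX in up; lra.
by rewrite mulrC ler_pdivlMr ?expR_gt0 // mul1r.
Qed.

(** Each image of a vertical segment of the box has a single level. By [ker] these levels differ
    modulo 1, so the images are disjoint arcs of one circle (the case [g = 0] of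
    [level_arcs_separated]). *)
Lemma len_arcs_sum (I : eqType) (J : seq I) (t : R) (n a : I -> int) : uniq J ->
  (forall i, i \in J -> `|t - (n i)%:~R * w - (a i)%:~R - t0| <= r1) ->
  (forall i j, i \in J -> j \in J -> i != j -> n i != n j /\
    `|(t - (n j)%:~R * w - (a j)%:~R) - (t - (n i)%:~R * w - (a i)%:~R)| < 2 * e) ->
  \sum_(i <- J) len (n i) (t - (n i)%:~R * w) <= 1.
Proof.
move=> uJ hJ hJ2.
pose p i := Ph (n i) (t - (n i)%:~R * w) x1; pose q i := Ph (n i) (t - (n i)%:~R * w) x2.
pose L i := s * (t - (n i)%:~R * w - (a i)%:~R - t0) + c + (n i)%:~R * rho.
have pq i : p i <= q i by rewrite Phi_le // ltW.
have lv i : i \in J -> h t (p i) = L i /\ h t (q i) = L i + 0.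
  move=> /hJ hi; have E x : Ph (n i) (t - (n i)%:~R * w) x1 <= x <= Ph (n i) (t - (n i)%:~R * w) x2 ->
      h t x = L i.
    by move=> /(level_image hi); rewrite subrK.
  by rewrite addr0; split; apply: E; rewrite lexx pq.
have sep i j (b : int) : i \in J -> j \in J -> i != j -> `|0 : R| < `|L i - L j + b%:~R|.
  move=> iJ jJ ij; have [nij hij] := hJ2 i j iJ jJ ij.
  rewrite normr0 normr_gt0.
  have -> : L i - L j + b%:~R = lev w rho s (n i - n j) (a j - a i) (- b).
    by rewrite /lev /L !intrB mulrNz; ring.
  apply: ker; first by rewrite subr_eq0.
  by move: hij; congr (`| _ | < _); rewrite !intrB; ring.
have g1 : `|0 : R| < 1 by rewrite normr0.
have [arc1 arc2] := level_arcs_separated g1 lv sep.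
apply: le_trans (sum_length_arcs uJ arc1 arc2).
by apply: ler_sum => i _; rewrite /len -/(p i) -/(q i) max_r // min_l.
Qed.

(** Rotation invariance of the mean shifts the [n]-th term by [- n w], which puts all images over
    the same fibre. *)
Lemma forward_mass (J : seq nat) : uniq J ->
  \sum_(n <- J) mean (fun t => chi t * len n%:Z t) <= 1.
Proof.
move=> uJ; pose f (n : nat) t := chi t * len n%:Z t.
have cf n : continuous (f n).
  by move=> t; apply: cvgM; [exact: cos_bump_cont|exact: len_cont].
have fp n t : f n (t + 1) = f n t by rewrite /f cos_bump_per len_per.
have -> : \sum_(n <- J) mean (f n) = mean (fun t => \sum_(n <- J) f n (t - n%:R * w)).
  rewrite mean_sum; last by move=> n; apply: shift_cont; exact: cf.
  by apply: eq_bigr => n _; rewrite mean_shift.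
rewrite -[leRHS]mean_cst; apply: mean_le; [|exact: cst_continuous|].
  by apply: sum_continuous => n; apply: shift_cont; exact: cf.
move=> t; rewrite (bigID (fun n : nat => chi (t - n%:R * w) != 0)) /= [X in (_ + X)]big1 ?addr0; last first.
  by move=> n /negPn/eqP z; rewrite /f z mul0r.
rewrite -big_filter; set J' := [seq _ <- _ | _].
have memJ n : n \in J' -> chi (t - n%:R * w) != 0 by rewrite mem_filter => /andP[].
have /choice[a ha] (n : nat) : exists a : int, chi (t - n%:R * w) != 0 ->
    `|t - n%:R * w - a%:~R - t0| < e / 2.
  have [z|nz] := boolP (chi (t - n%:R * w) == 0); first by exists 0.
  by have [a hA] := chi_supp nz; exists a.
apply: le_trans (@len_arcs_sum _ J' t (fun n => n%:Z) a _ _ _).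
- apply: ler_sum => n _; rewrite /f -pmulrn ler_piMl ?cos_bump_le1 //.
  by apply/ltW; exact: len_gt0.
- exact: filter_uniq.
- by move=> n /memJ/ha hn; apply: norm_half_base; rewrite -pmulrn.
- move=> i j /memJ/ha hi /memJ/ha hj ij; split; first by [].
  move: hi hj; rewrite -!pmulrn !ltr_norml => /andP[? ?] /andP[? ?].
  by have := e0 => ?; apply/andP; split; lra.
Qed.

(** The [(- n)]-th image of the segment over [t + n w] already lies over [t]; the closeness of [n w]
    to an integer keeps [t + n w] over the box. *)
Lemma backward_mass (J : seq nat) (a : nat -> int) : uniq J ->
  (forall n, n \in J -> `|n%:R * w - (a n)%:~R| < e) ->
  \sum_(n <- J) mean (fun t => chi t * len (- n%:Z) (t + n%:R * w)) <= 1.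
Proof.
move=> uJ ha; rewrite -mean_sum; last first.
  move=> n t; apply: cvgM; first exact: cos_bump_cont.
  by apply: shift_cont; exact: len_cont.
rewrite -[leRHS]mean_cst; apply: mean_le; [|exact: cst_continuous|].
  apply: sum_continuous => n t; apply: cvgM; first exact: cos_bump_cont.
  by apply: shift_cont; exact: len_cont.
move=> t; rewrite -mulr_sumr.
have [z|nz] := eqVneq (chi t) 0; first by rewrite z mul0r.
have [a0 ha0] := chi_supp nz.
have S0 : 0 <= \sum_(n <- J) len (- n%:Z) (t + n%:R * w).
  by apply: sumr_ge0 => n _; apply/ltW; exact: len_gt0.
apply: le_trans (_ : \sum_(n <- J) len (- n%:Z) (t + n%:R * w) <= _).
  by rewrite ler_piMl // cos_bump_le1.
have E (n : nat) : t + n%:R * w = t - (- n%:Z)%:~R * w by rewrite mulrNz -pmulrn; ring.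
under eq_bigr => n _ do rewrite E.
apply: (@len_arcs_sum _ J t (fun n => - n%:Z) (fun n => a0 + a n)) => //.
- move=> n /ha hn; apply: norm_double_base.
  rewrite -E intrD (_ : _ - t0 = (t - a0%:~R - t0) + (n%:R * w - (a n)%:~R)); last by ring.
  by apply: le_lt_trans (ler_normD _ _) _; have := e0; lra.
- move=> i j /ha hi /ha hj ij; split; first by rewrite eqr_opp.
  rewrite -!E !intrD.
  rewrite (_ : _ - _ = (j%:R * w - (a j)%:~R) - (i%:R * w - (a i)%:~R)); last by ring.
  by apply: le_lt_trans (ler_normB _ _) _; lra.
Qed.

(** More than [2 / m] distinct closest returns, each with mass at least [m], exceed the total of 2
    allowed by the forward and backward bounds. *)
Lemma denjoy_contradiction : False.
Proof.
have [m m0 hm] := record_mass.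
have rec K : exists J : seq nat, [/\ uniq J, size J = K &
    forall n, n \in J -> exists a b, closest_return w rho s e n a b].
  elim: K => [|K [J [uJ sJ hJ]]]; first by exists [::].
  (* [sumn J] bounds every element of [J], so the next return is new. *)
  have [n [a [b [nJ cr]]]] := closest_returns e0 e4 ker (sumn J).
  exists (n :: J); split => /=; [|by rewrite sJ|].
    rewrite uJ andbT; apply/negP => nJ'; move: nJ.
    by rewrite (perm_sumn (perm_to_rem nJ')) /= ltnNge leq_addr.
  by move=> k; rewrite inE => /predU1P[->|/hJ //]; exists a, b.
pose K := (Num.trunc (2 / m)).+1.
have [J [uJ sJ hJ]] := rec K.
have /choice[a ha] (n : nat) : exists a : int, n \in J -> `|n%:R * w - a%:~R| < e.
  have [nJ|nJ] := boolP (n \in J); last by exists 0.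
  by have [a [b []]] := hJ n nJ; exists a.
have f1 := forward_mass uJ; have f2 := backward_mass uJ ha.
have : m * K%:R <= 2.
  apply: le_trans (_ : \sum_(n <- J) (mean (fun t => chi t * len n%:Z t)
     + mean (fun t => chi t * len (- n%:Z) (t + n%:R * w))) <= _).
    rewrite -sJ -sum1_size natr_sum mulr_sumr mulr1 big_seq [leRHS]big_seq.
    by apply: ler_sum => n nJ; have [a' [b' cr]] := hJ n nJ; exact: hm cr.
  by rewrite big_split /=; lra.
by rewrite mulrC -ler_pdivlMr // leNgt truncnS_gt.
Qed.

End Denjoy.

(** * Tubes in the rationally related case *)

Lemma continuous_pair {R : realType} (T : topologicalType) (f g : T -> R) z :
  {for z, continuous f} -> {for z, continuous g} ->
  {for z, continuous (fun z => (f z, g z))}.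
Proof. by move=> cf cg; exact: (cvg_pair cf cg). Qed.

Section Tubes.
Context {R : realType}.
Variables (w : R) (F : R -> R -> R).
Hypothesis hF : fibre_homeo F.
Hypothesis wi : irrational w.
Variables (rho M : R).
Hypothesis dev : forall n t x, `|Phi w F n t x - x - n%:~R * rho| <= M.
Variables (d : nat) (k l : int).
Hypothesis d0 : (0 < d)%N.
Hypothesis rel : d%:R * rho = k%:~R * w + l%:~R.
Hypothesis bez : exists a b c : int, a * l + b * k + c * d%:Z = 1.
Local Notation Ph := (Phi w F).
Local Notation h := (hsup w F rho).

Let hs : semiconj w F rho M h := hsup_semiconj hF dev.

Definition act (n a b : int) (z : R * R) : R * R :=
  (z.1 + n%:~R * w - a%:~R, Ph n z.1 z.2 - b%:~R).

(** The change of [height] under [act n a b]; the relation [rel] makes it an integer. *)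
Definition shift (n a b : int) : int := n * l - b * d%:Z + a * k.

Definition height (z : R * R) : R := d%:R * h z.1 z.2 - k%:~R * z.1.

Definition above (j : int) : set (R * R) := [set z | j%:~R < height z].

(* The interior makes the upper boundary lower semicontinuous. *)
Definition strip (j : int) : set (R * R) := above j `&` (~` above (j + 1))°.

Lemma act_cont n a b : continuous (act n a b).
Proof.
move=> z.
have c1 : {for z, continuous (fun z : R * R => z.1 + n%:~R * w - a%:~R)}.
  apply: cvgB; last exact: cvg_cst.
  by apply: cvgD; [exact: cvg_fst|exact: cvg_cst].
have c2 : {for z, continuous (fun z : R * R => Ph n z.1 z.2 - b%:~R)}.
  apply: cvgB; last exact: cvg_cst.
  exact: (@Phi_cont _ w F hF n z).
exact: (continuous_pair c1 c2).
Qed.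

Lemma actK n a b : cancel (act n a b) (act (- n) (- a) (- b)).
Proof.
move=> [t x]; rewrite /act /=; congr (_, _).
  by rewrite !mulrNz; ring.
have E1 := Phi_per w hF (- n) (t + n%:~R * w - a%:~R) a (Ph n t x - b%:~R).
rewrite subrK in E1.
have E2 := Phi_deg w hF (- n) (t + n%:~R * w) (Ph n t x - b%:~R) b.
rewrite subrK PhiK // in E2.
by rewrite mulrNz opprK -E1 -E2.
Qed.

Lemma height_act n a b z : height (act n a b z) = height z + (shift n a b)%:~R.
Proof.
case: z => t x; rewrite /height /act /= (semiconj_lift _ _ _ _ _ hs).
rewrite /shift intrD intrB !intrM -!pmulrn; have := rel => E.
have -> : l%:~R = d%:R * rho - k%:~R * w by rewrite E; ring.
by ring.
Qed.

Lemma above_act n a b j z : above (j + shift n a b) (act n a b z) <-> above j z.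
Proof. by rewrite /above /= height_act intrD ltrD2r. Qed.

(** The inverse of [act] is continuous, so it pulls a neighbourhood avoiding [above j] back to one
    of the image point. *)
Lemma below_act n a b j z : (~` above j)° z -> (~` above (j + shift n a b))° (act n a b z).
Proof.
have shN : shift (- n) (- a) (- b) = - shift n a b by rewrite /shift; ring.
have aK : act (- n) (- a) (- b) (act n a b z) = z by rewrite actK.
move=> hz; have H : nbhs (act n a b z) (act (- n) (- a) (- b) @^-1` (~` above j)).
  by have := @act_cont (- n) (- a) (- b) (act n a b z) (~` above j); rewrite aK => /(_ hz).
rewrite /interior; apply: filterS H => y /= ny yj; apply: ny.
apply/(above_act n a b).
by have := actK (- n) (- a) (- b) y; rewrite !opprK => ->.
Qed.

Lemma strip_act n a b j z : strip (j + shift n a b) (act n a b z) <-> strip j z.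
Proof.
have fwd n' a' b' j' y : strip j' y -> strip (j' + shift n' a' b') (act n' a' b' y).
  by move=> [h1 h2]; split; [apply/above_act|rewrite addrAC; exact: below_act].
split; last exact: fwd.
move=> /(fwd (- n) (- a) (- b)); rewrite actK.
by rewrite (_ : _ + _ = j) // /shift; ring.
Qed.

Lemma above_open j : open (above j).
Proof.
rewrite openE => -[t x] /= hz; rewrite /interior.
have dR : 0 < d%:R :> R by rewrite ltr0n.
pose v := (j%:~R + k%:~R * t) / d%:R.
have lt : v < h t x by rewrite ltr_pdivrMr // mulrC; move: hz; rewrite /above /height /=; lra.
pose m := (v + h t x) / 2.
have lt1 : m < h t x by rewrite /m; lra.
have vm : v < m by rewrite /m; lra.
have c1 : continuous (fun z : R * R => (j%:~R + k%:~R * z.1) / d%:R).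
  move=> z; apply: cvgM; last exact: cvg_cst.
  apply: cvgD; first exact: cvg_cst.
  by apply: cvgM; [exact: cvg_cst|exact: cvg_fst].
have := hsup_lsc hF dev lt1.
have : \forall z \near (t, x), (j%:~R + k%:~R * z.1) / d%:R < m.
  exact: (cvgr_lt _ (c1 (t, x))).
apply: filterS2 => z /= l1 l2; have := lt_trans l1 l2.
by rewrite ltr_pdivrMr // /above /height /= mulrC; lra.
Qed.

Lemma strip_open j : open (strip j).
Proof. by apply: openI; [exact: above_open|exact: open_interior]. Qed.

Lemma above_up j t x y : x <= y -> above j (t, x) -> above j (t, y).
Proof.
move=> xy; rewrite /above /height /= => /lt_le_trans; apply.
by rewrite lerD2r ler_wpM2l // (semiconj_mono hs).
Qed.

Lemma below_down j t x y : x <= y -> (~` above j)° (t, y) -> (~` above j)° (t, x).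
Proof.
move=> xy hy; pose f (z : R * R) := (z.1, z.2 + (y - x)).
have c1 : {for (t, x), continuous (fun z : R * R => z.2 + (y - x))}.
  by apply: cvgD; [exact: cvg_snd|exact: cvg_cst].
have c2 : {for (t, x), continuous (fun z : R * R => z.1)} by exact: cvg_fst.
have cf : {for (t, x), continuous f} := continuous_pair c2 c1.
have fx : f (t, x) = (t, y) by rewrite /f /= addrC subrK.
have H : nbhs (t, x) (f @^-1` (~` above j)).
  by have := cf (~` above j); rewrite fx => /(_ hy).
rewrite /interior; apply: filterS H => -[t' x'] /= nz hz; apply: nz.
by apply: above_up hz; rewrite lerDl subr_ge0.
Qed.

Lemma strip_convex j t x y z : x <= y <= z -> strip j (t, x) -> strip j (t, z) -> strip j (t, y).
Proof.
move=> /andP[xy yz] [hx _] [_ hz]; split; first exact: above_up hx.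
exact: below_down hz.
Qed.

Lemma strip_height j z : strip j z -> j%:~R < height z <= (j + 1)%:~R.
Proof.
move=> [h1 /interior_subset h2]; rewrite h1 /=.
by rewrite leNgt; apply/negP.
Qed.

Lemma strip_lt i j t x y : (i < j)%R -> strip i (t, x) -> strip j (t, y) -> x < y.
Proof.
move=> ij /strip_height/andP[_ hx] /strip_height/andP[hy _].
rewrite ltNge; apply/negP => yx.
have : height (t, y) <= height (t, x).
  by rewrite /height /= lerD2r ler_wpM2l // (semiconj_mono hs).
have : (i + 1)%:~R <= j%:~R :> R by rewrite ler_int; lia.
lra.
Qed.

Lemma strip_inj i j z : strip i z -> strip j z -> i = j.
Proof.
case: z => t x hi hj; case: (ltgtP i j) => // ij.
  by have := strip_lt ij hi hj; rewrite ltxx.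
by have := strip_lt ij hj hi; rewrite ltxx.
Qed.

Lemma shift_onto (j : int) : exists n a b, shift n a b = j.
Proof.
have [n [a [b E]]] := bez; exists (n * j), (a * j), (- (b * j)).
by rewrite -[RHS]mul1r -E /shift; ring.
Qed.

(* If every strip were empty, each above j would be dense in above 0, against the local boundedness of height. *)
Lemma some_strip_nonempty : exists j z, strip j z.
Proof.
apply: contrapT => ne.
have dense (J : nat) z (A : set (R * R)) : above 0 z -> open A -> A z ->
    exists2 y, A y & above J%:Z y.
  move=> hz oA Az; elim: J => [|J [y Ay hy]]; first by exists z.
  have : ~ (~` above (J%:Z + 1))° y by move=> hy'; apply: ne; exists J%:Z, y.
  rewrite /interior => nn; apply: contrapT => C; apply: nn.
  have := open_nbhs_nbhs (conj oA Ay); apply: filterS => v Av hv; apply: C.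
  by exists v => //; move: hv; rewrite -PoszD addn1.
have dR : 0 < d%:R :> R by rewrite ltr0n.
pose x := M + 1; have hx : above 0 (0, x).
  rewrite /above /height /= mulr0 subr0 mulr_gt0 //.
  by have := semiconj_near hs 0 x; rewrite ler_norml /x => /andP[? ?]; lra.
pose C := d%:R * (x + 1 + M) + `|k%:~R|.
have C0 : 0 <= C.
  have M0 : 0 <= M by apply: le_trans (dev 0 0 0); exact: normr_ge0.
  by rewrite addr_ge0 // mulr_ge0 // /x; lra.
have bA : open (ball (0 : R, x) 1) by exact: ball_open.
have [y [By1 By2] hy] := dense (Num.trunc C).+1 (0, x) _ hx bA (ballxx _ ltr01).
move: By1 By2 hy; case: y => t y; rewrite /ball /= => bt by'.
rewrite /above /height /= -pmulrn.
have := truncnS_gt C; have := semiconj_near hs t y.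
move: bt by'; rewrite sub0r normrN distrC => bt.
rewrite ltr_norml ler_norml => /andP[b1 b2] /andP[b3 b4] b5 b6.
have : d%:R * h t y <= d%:R * (x + 1 + M) by rewrite ler_pM2l //; lra.
have : - (k%:~R * t) <= `|k%:~R|.
  apply: le_trans (ler_norm _) _; rewrite normrN normrM.
  by rewrite ler_piMr // ltW.
by rewrite /C in b5; lra.
Qed.

(** Some strip is nonempty, and by [shift_onto] so is strip [j]. Being open, it contains points over
    a small interval, and the actions with [shift] zero, which preserve the strip, move that
    interval over every [t]. *)
Lemma strip_over_all j t : exists x, strip j (t, x).
Proof.
have [i [z hz]] := some_strip_nonempty.
have [n [a [b E]]] := shift_onto (j - i).
have hz' : strip j (act n a b z) by rewrite -(subrK i j) addrC -E; apply/strip_act.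
move: (act n a b z) hz' => -[t1 x1] {n a b E z hz} hz.
have := open_nbhs_nbhs (conj (@strip_open j) hz) => /nbhs_ballP[r /= r0 hr].
have dR : 0 < d%:R :> R by rewrite ltr0n.
have rd : 0 < r / d%:R by rewrite divr_gt0.
have [N hN] := dense_rotation_bounded wi rd.
have [m [c [_ hm]]] := hN ((t1 - t) / d%:R).
pose t' := t - d%:R * (m%:R * w - c%:~R).
have ht' : `|t1 - t'| < r.
  have -> : t1 - t' = d%:R * ((t1 - t) / d%:R + m%:R * w - c%:~R).
    by rewrite /t'; field; rewrite gt_eqF.
  by rewrite normrM (gtr0_norm dR) mulrC -ltr_pdivlMr.
have s1 : strip j (t', x1).
  by apply: hr; split => //=; rewrite /ball /= subrr normr0.
(* These are zeros of [shift] that translate the base by [d * (m w - c)]; hence the division by [d]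
   in the approximation. *)
pose n := (d * m)%N%:Z; pose a := d%:Z * c; pose b := l * m%:Z + k * c.
have sh : shift n a b = 0 by rewrite /shift /n /a /b PoszM; ring.
exists (act n a b (t', x1)).2.
have -> : (t, (act n a b (t', x1)).2) = act n a b (t', x1).
  congr (_, _); rewrite /t' /n /a /= intrM -!pmulrn natrM; ring.
by rewrite -[j]addr0 -sh; apply/strip_act.
Qed.

Lemma strip_fibre_open j t : open [set x | strip j (t, x)].
Proof.
have c1 : continuous (fun x : R => (t, x)).
  move=> x; have c2 : {for x, continuous (fun=> t : R)} by exact: cst_continuous.
  have c3 : {for x, continuous (@id R)} by exact: cvg_id.
  exact: (continuous_pair c2 c3).
by have := (continuousP _).1 c1 _ (@strip_open j).
Qed.

(** The fibre is open, convex and nonempty, and it is bounded by points of the two neighbouring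
    strips. *)
Lemma strip_fibre_interval j t : exists ab : R * R, ab.1 < ab.2 /\
  forall x, strip j (t, x) <-> ab.1 < x < ab.2.
Proof.
pose S := [set x | strip j (t, x)].
have [x0 hx0] := strip_over_all j t.
have [x1 hx1] := strip_over_all (j - 1) t; have [x2 hx2] := strip_over_all (j + 1) t.
have lb x : S x -> x1 < x by move=> hx; apply: strip_lt hx1 hx; lia.
have ub x : S x -> x < x2 by move=> hx; apply: strip_lt hx hx2; lia.
have hi : has_inf S by split; [exists x0|exists x1 => x /lb/ltW].
have hsu : has_sup S by split; [exists x0|exists x2 => x /ub/ltW].
have oS : open S by exact: strip_fibre_open.
have P x : S x <-> inf S < x < sup S.
  split=> [hx|/andP[ix xs]].
    have := open_nbhs_nbhs (conj oS hx) => /nbhs_ballP[r /= r0 hr].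
    have l1 : inf S <= x - r / 2.
      by apply: ge_inf; [exact: hi.2|apply: hr; rewrite /ball /= opprD opprK addrA subrr add0r gtr0_norm; lra].
    have l2 : x + r / 2 <= sup S.
      by apply: sup_upper_bound => //; apply: hr; rewrite /ball /= opprD addrA subrr sub0r normrN gtr0_norm; lra.
    by apply/andP; split; lra.
  have [y Sy yx] := inf_lt hi.1 ix; have [z Sz xz] := sup_gt hsu.1 xs.
  by apply: (strip_convex (x := y) (z := z)) => //; rewrite (ltW yx) (ltW xz).
exists (inf S, sup S); split => //=; have /P/andP[? ?] := hx0; lra.
Qed.

Let p := gcdz d%:Z k.
Let q := (d%:Z %/ p)%Z.

(** Deck translations change the strip index by [a * k - b * d], that is by the multiples of [p], so
    a residue class modulo [p] is the smallest periodic union of strips. *)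
Definition band (i : int) : set (R * R) := [set z | exists j, (p %| j - i)%Z /\ strip j z].

Lemma p_dvd_d : (p %| d%:Z)%Z. Proof. exact: dvdz_gcdl. Qed.
Lemma p_dvd_k : (p %| k)%Z. Proof. exact: dvdz_gcdr. Qed.

Lemma band_act n a b i z : band (i + n * l) (act n a b z) <-> band i z.
Proof.
have pd : (p %| shift n a b - n * l)%Z.
  rewrite (_ : _ - _ = a * k - b * d%:Z); last by rewrite /shift; ring.
  by rewrite rpredB // dvdz_mull ?p_dvd_d ?p_dvd_k.
split=> -[j [pj hj]].
  exists (j - shift n a b); split.
    rewrite (_ : _ - i = (j - (i + n * l)) - (shift n a b - n * l)); last by ring.
    by rewrite rpredB.
  by apply/(strip_act n a b); rewrite subrK.
exists (j + shift n a b); split; last by apply/strip_act.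
rewrite (_ : _ - _ = (j - i) + (shift n a b - n * l)); last by ring.
by rewrite rpredD.
Qed.

Lemma p_gt0 : 0 < p.
Proof. by rewrite lt_neqAle eq_sym gcdz_eq0 negb_and -lt0n d0. Qed.

Lemma q_gt0 : 0 < q.
Proof.
have := divzK p_dvd_d; rewrite -/q => E.
by rewrite -(pmulr_lgt0 _ p_gt0) E ltz_nat.
Qed.

Lemma dE : d%:Z = q * p. Proof. by rewrite divzK ?p_dvd_d. Qed.

Lemma band_congr i i' z : (p %| i - i')%Z -> band i z -> band i' z.
Proof.
move=> pi [j [pj hj]]; exists j; split => //.
by rewrite (_ : j - i' = (j - i) + (i - i')); [rewrite rpredD|ring].
Qed.

Lemma band_open i : open (band i).
Proof.
have -> : band i = \bigcup_(j in [set j | (p %| j - i)%Z]) strip j.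
  by apply/seteqP; split=> z [j]; [move=> [pj hj]; exists j|move=> pj hj; exists j].
by apply: bigcup_open => j _; exact: strip_open.
Qed.

Lemma act_translation (a b : int) z : act 0 (- a) (- b) z = (z.1 + a%:~R, z.2 + b%:~R).
Proof. by rewrite /act mul0r addr0 Phi0 !mulrNz !opprK. Qed.

Lemma band_periodic i : periodic_set (band i).
Proof.
move=> z m n; rewrite -act_translation.
by rewrite -(band_act 0 (- m) (- n) i z) mul0r addr0.
Qed.

Lemma iter_act n z : iter n (skew_lift w F) z = act n 0 0 z.
Proof. by case: z => t x; rewrite Phi_iter // /act /= !subr0. Qed.

Lemma band_iter n i z : band (i + n%:Z * l) (iter n (skew_lift w F) z) <-> band i z.
Proof. by rewrite iter_act; exact: band_act. Qed.

(** Modulo the translation by 1, which raises the index by [d = q * p], the multiples of [p] are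
    represented by [p * i] with [0 <= i < q]. *)
Lemma band_fibre_intervals : fibre_q_intervals (band 0) `|q|%N.
Proof.
move=> t; have /choice[ab hab] j := strip_fibre_interval j t.
have qE : `|q|%N%:Z = q by rewrite gez0_abs // ltW // q_gt0.
have sep (i j : int) : i < j -> (ab i).2 <= (ab j).1.
  move=> ij; rewrite leNgt; apply/negP => lt.
  have [hi1 hi2] := hab i; have [hj1 hj2] := hab j.
  pose x := (Num.max (ab i).1 (ab j).1 + (ab i).2) / 2.
  have mx : Num.max (ab i).1 (ab j).1 < (ab i).2 by rewrite gt_max hi1.
  have x2 : x < (ab i).2 by rewrite /x; lra.
  have : Num.max (ab i).1 (ab j).1 < x by rewrite /x; lra.
  rewrite gt_max => /andP[x1 x3].
  pose y := ((ab j).1 + Num.min x (ab j).2) / 2.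
  have my : (ab j).1 < Num.min x (ab j).2 by rewrite lt_min x3.
  have y1 : (ab j).1 < y by rewrite /y; lra.
  have : y < Num.min x (ab j).2 by rewrite /y; lra.
  rewrite lt_min => /andP[y3 y2].
  have hx : strip i (t, x) by apply/hi2; rewrite x1.
  have hy : strip j (t, y) by apply/hj2; rewrite y1.
  by have := strip_lt ij hx hy; lra.
have down (j c : int) x : strip j (t, x) -> strip (j - c * d%:Z) (t, x - c%:~R).
  move=> /(strip_act 0 0 c); rewrite /act /shift /= Phi0.
  by rewrite !mul0r addr0 subr0 add0r addr0.
(* Strip [d] is strip 0 moved up by 1, so the last interval ends before the first one recurs. *)
have top : (ab d%:Z).1 <= (ab 0).1 + 1.
  rewrite leNgt; apply/negP => lt; have [h1 h2] := hab 0; have [h3 h4] := hab d%:Z.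
  pose y := ((ab 0).1 + Num.min (ab 0).2 ((ab d%:Z).1 - 1)) / 2.
  have my : (ab 0).1 < Num.min (ab 0).2 ((ab d%:Z).1 - 1) by rewrite lt_min h1 /=; lra.
  have y1 : (ab 0).1 < y by rewrite /y; lra.
  have : y < Num.min (ab 0).2 ((ab d%:Z).1 - 1) by rewrite /y; lra.
  rewrite lt_min => /andP[y2 y3].
  have hy : strip 0 (t, y) by apply/h2; rewrite y1.
  have := down 0 (- 1) y hy; rewrite mulN1r opprK add0r (_ : y - (- 1)%:~R = y + 1); last by ring.
  move=> /h4/andP[hh _]; move: y3; rewrite ltrBrDr => /(lt_trans hh).
  by rewrite ltxx.
exists (fun i => (ab (p * i%:Z)).1), (fun i => (ab (p * i%:Z)).2); split.
- by move=> j _; have [] := hab (p * j%:Z).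
- by move=> j _; apply: sep; rewrite ltr_pM2l ?p_gt0 // ltz_nat.
- move=> q0; rewrite mulr0; apply: le_trans top; apply: sep.
  by rewrite dE mulrC ltr_pM2r ?p_gt0 // -[X in _ < X]qE ltz_nat ltn_predL.
- move=> x; split.
    move=> [j []]; rewrite subr0 => pj hj.
    pose i := (j %/ p)%Z; have jE : j = i * p by rewrite /i divzK.
    pose i0 := (i %% q)%Z; pose c := (i %/ q)%Z.
    have q0 := q_gt0.
    have i00 : 0 <= i0 by rewrite modz_ge0 // gt_eqF.
    have i0q : i0 < q by rewrite ltz_pmod.
    have iE : i = c * q + i0 by exact: divz_eq.
    (* Euclidean division [i = c * q + i0]: moving down by [c] takes strip [p * i] to strip
       [p * i0]. *)
    exists `|i0|%N, (- c); rewrite gez0_abs //; split.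
      by rewrite -ltz_nat qE gez0_abs.
    have [_ h2] := hab (p * i0); apply/h2; rewrite mulrNz.
    have := down j c x hj; rewrite (_ : j - c * d%:Z = p * i0) //.
    by rewrite jE iE dE; ring.
  move=> [j [m [jq hm]]]; have [_ h2] := hab (p * j%:Z).
  have hb : band 0 (t, x + m%:~R).
    by exists (p * j%:Z); split; [rewrite subr0 dvdz_mulr|apply/h2].
  by apply/(band_periodic 0 (t, x) 0 m); rewrite /= addr0.
Qed.

Lemma clopen_interval (I P Q : set R) : is_interval I -> open P -> open Q ->
  I `<=` P `|` Q -> I `&` P `&` Q = set0 -> I `&` P !=set0 -> I `<=` P.
Proof.
move=> /connected_intervalP cI oP oQ IPQ IPQ0 IP0.
have E := cI (I `&` P) IP0; rewrite -E; first exact: subIsetr.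
  by exists P.
exists (~` Q); first exact: open_closedC.
apply/seteqP; split=> x [Ix hx]; split => //.
  by move=> Qx; have : set0 x by rewrite -IPQ0.
by case: (IPQ x Ix).
Qed.

(** Each fibre is an interval and lies wholly in [A] or wholly in [B]. The sets of base points of
    the two kinds are open, disjoint and cover the line, so one of them is empty. *)
Lemma strip_connected (A B : set (R * R)) j : open A -> open B ->
  strip j `<=` A `|` B -> strip j `&` A `&` B = set0 -> strip j `&` A !=set0 ->
  strip j `<=` A.
Proof.
move=> oA oB cov dis [[t0 x0] [hS hA]].
have slice (C : set (R * R)) t : open C -> open [set x | C (t, x)].
  move=> oC; have c1 : continuous (fun x : R => (t, x)).
    move=> x; have c2 : {for x, continuous (fun=> t : R)} by exact: cst_continuous.
    have c3 : {for x, continuous (@id R)} by exact: cvg_id.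
    exact: (continuous_pair c2 c3).
  exact: ((continuousP _).1 c1 _ oC).
pose fib t := [set x | strip j (t, x)].
have ifib t : is_interval (fib t).
  move=> x z hx hz y xyz; exact: (strip_convex xyz hx hz).
have fibre (C D : set (R * R)) t x : open C -> open D -> strip j `<=` C `|` D ->
    strip j `&` C `&` D = set0 -> strip j (t, x) -> C (t, x) ->
    forall y, strip j (t, y) -> C (t, y).
  move=> oC oD cov' dis' hx Cx y hy.
  apply: (@clopen_interval (fib t) [set x | C (t, x)] [set x | D (t, x)]) => //.
  - exact: slice.
  - exact: slice.
  - by move=> z /cov'.
  - by apply/seteqP; split=> // z [[h1 h2] h3]; have : set0 (t, z) by rewrite -dis'.
  - by exists x.
have base (C D : set (R * R)) : open C -> open D -> strip j `<=` C `|` D ->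
    strip j `&` C `&` D = set0 -> open [set t | exists2 x, strip j (t, x) & C (t, x)].
  move=> oC oD cov' dis'; rewrite openE => t /= [x hx Cx]; rewrite /interior.
  have oSC : open (strip j `&` C) by apply: openI => //; exact: strip_open.
  have := open_nbhs_nbhs (conj oSC (conj hx Cx)) => /nbhs_ballP[r /= r0 hr].
  apply/nbhs_ballP; exists r => //= t' ht'.
  have [] : (strip j `&` C) (t', x) by apply: hr; split => //=; exact: ballxx.
  by exists x.
have disC : strip j `&` B `&` A = set0 by rewrite -setIA (setIC B) setIA.
have covC : strip j `<=` B `|` A by rewrite setUC.
have := @clopen_interval setT _ _ _ (base A B oA oB cov dis) (base B A oB oA covC disC).
have iT : is_interval (@setT R) by [].
move=> /(_ iT) H [t y] hy.
have [x hx Ax] : [set t | exists2 x, strip j (t, x) & A (t, x)] t; last exact: (fibre A B t x).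
apply: H => //.
- move=> s _; have [x hx] := strip_over_all j s.
  by case: (cov _ hx) => ?; [left|right]; exists x.
- apply/seteqP; split=> // s [[_ [x hx Ax]] [z hz Bz]].
  have Az := fibre A B s x oA oB cov dis hx Ax z hz.
  by have : set0 (s, z) by rewrite -dis.
- by exists t0; split => //; exists x0.
Qed.

(** A periodic [A] that meets strip [j] also meets strip [j'], by a deck translation, and then
    contains it; so [B] cannot meet strip [j']. *)
Lemma band_connected i : torus_connected (band i).
Proof.
move=> A B [pA oA] [pB oB] cov dis; apply: contrapT.
move=> /not_orP[/eqP/set0P[z [[j [pj hj]] Az]] /eqP/set0P[z' [[j' [pj' hj']] Bz']]].
have sub m : (p %| m - i)%Z -> strip m `<=` band i by move=> pm y hy; exists m.
have covj m : (p %| m - i)%Z -> strip m `<=` A `|` B by move=> pm y /(sub _ pm)/cov.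
have disj m : (p %| m - i)%Z -> strip m `&` A `&` B = set0.
  move=> pm; apply/seteqP; split=> // y [[/(sub _ pm) h1 h2] h3].
  by have : set0 y by rewrite -dis.
have pjj : (p %| j' - j)%Z.
  by rewrite (_ : j' - j = (j' - i) - (j - i)); [rewrite rpredB|ring].
(* Bezout for [p = gcd(d, k)]: deck translations alone join any two strips of the band. *)
have [a [b E]] : exists a b : int, a * k - b * d%:Z = j' - j.
  have [u [v uv]] := Bezoutz d%:Z k; have {}pjj := divzK pjj.
  exists (((j' - j) %/ p)%Z * v), (- (((j' - j) %/ p)%Z * u)).
  by rewrite -[RHS]pjj /p -uv; ring.
have hz : strip j' (act 0 a b z).
  have -> : j' = j + shift 0 a b by rewrite /shift mul0r add0r addrC; move: E; lia.
  exact/strip_act.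
have Aact : A (act 0 a b z).
  by rewrite -[a]opprK -[b]opprK act_translation; exact: (pA z (- a) (- b)).1.
have : strip j' `<=` A.
  by apply: (strip_connected oA oB (covj _ pj') (disj _ pj')); exists (act 0 a b z).
move=> /(_ _ hj') Az'; have : set0 z' by rewrite -(disj j' pj').
by [].
Qed.

(** By [bez], [l] is invertible modulo [p]. Hence the bands [i * l] with [0 <= i < p], which contain
    the successive images of [band 0], are distinct. *)
Lemma coprime_p_l (m : int) : (p %| m * l)%Z -> (p %| m)%Z.
Proof.
move=> pm; have [a [b [c E]]] := bez.
rewrite -[m]mulr1 -E (_ : m * _ = a * (m * l) + (m * b) * k + (m * c) * d%:Z); last by ring.
by rewrite !rpredD // dvdz_mull ?p_dvd_k ?p_dvd_d.
Qed.

Lemma band_pq_tube :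
  pq_tube w F `|p|%N `|q|%N
    (\bigcup_(i in [set i | (i < `|p|)%N]) (iter i (skew_lift w F) @` band 0)).
Proof.
have pE : `|p|%N%:Z = p by rewrite gez0_abs // ltW // p_gt0.
exists (band 0); split => //.
  split.
  - by split; [exact: band_periodic|exact: band_open].
  - have pl : (p %| `|p|%N%:Z * l)%Z by rewrite pE dvdz_mulr.
    move=> z; split=> hz.
      have := (band_iter `|p|%N 0 z).2 hz; apply: band_congr.
      by rewrite subr0 add0r.
    apply/(band_iter `|p|%N 0 z); apply: band_congr hz.
    by rewrite sub0r add0r rpredN.
  - exact: band_fibre_intervals.
  - exact: band_connected.
move=> i j ij jp; apply/seteqP; split=> // z [[z1 h1 <-] [z2 h2 E]].
have := (band_iter i 0 z1).2 h1; have := (band_iter j 0 z2).2 h2; rewrite E !add0r.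
move=> [j1 [pj1 hj1]] [j2 [pj2 hj2]]; have jj := strip_inj hj1 hj2; subst j2.
have : (p %| (j%:Z - i%:Z) * l)%Z.
  rewrite (_ : _ * l = (j1 - i%:Z * l) - (j1 - j%:Z * l)); last by ring.
  by rewrite rpredB.
move=> /coprime_p_l; rewrite -pE subzn ?(ltnW ij) // dvdzE /= => /dvdn_leq.
rewrite subn_gt0 ij => /(_ isT) le.
by have := leq_ltn_trans (leq_trans le (leq_subr i j)) jp; rewrite ltnn.
Qed.

Lemma rho_rational : exists k' : int,
  rho = k'%:~R / `|q|%N%:R * w + l%:~R / (`|p|%N * `|q|%N)%:R.
Proof.
exists (k %/ p)%Z.
have qE : `|q|%N%:Z = q by rewrite gez0_abs // ltW // q_gt0.
have pE : `|p|%N%:Z = p by rewrite gez0_abs // ltW // p_gt0.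
have q0 : (q%:~R : R) != 0 by rewrite intr_eq0 gt_eqF // q_gt0.
have p0 : (p%:~R : R) != 0 by rewrite intr_eq0 gt_eqF // p_gt0.
rewrite natrM !pmulrn pE qE.
have kE : k%:~R = (k %/ p)%Z%:~R * p%:~R :> R by rewrite -intrM divzK ?p_dvd_k.
have := rel; rewrite pmulrn dE intrM kE => E.
by apply: (mulfI (mulf_neq0 q0 p0)); rewrite E; field; rewrite q0 p0.
Qed.

End Tubes.

(** * The minimal integer relation and the conclusion *)

Lemma minimal_relation {R : realType} (w rho : R) : rationally_related w rho ->
  exists (d : nat) (k l : int), [/\ (0 < d)%N, d%:R * rho = k%:~R * w + l%:~R &
    exists a b c : int, a * l + b * k + c * d%:Z = 1].
Proof.
move=> [A [B [C [B0 E]]]].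
pose P (d : nat) := `[< (0 < d)%N /\ exists k l : int, d%:R * rho = k%:~R * w + l%:~R >].
have exP : exists d, P d.
  exists `|B|%N; apply/asboolP; split; first by rewrite absz_gt0.
  have [BE|BE] : `|B|%N%:Z = B \/ `|B|%N%:Z = - B by lia.
    exists (- A), (- C); rewrite pmulrn BE !mulrNz; lra.
  by exists A, C; rewrite pmulrn BE !mulrNz; lra.
(* With [d] least, a common divisor of [d], [k] and [l] could be divided out and must be 1; two
   Bezout identities then give the coefficients. *)
case: (ex_minnP exP) => d /asboolP[d0 [k [l rel]]] dmin.
exists d, k, l; split => //.
pose g := gcdz (gcdz d%:Z k) l.
have gd : (g %| d%:Z)%Z by rewrite (dvdz_trans (dvdz_gcdl _ _)) ?dvdz_gcdl.
have gk : (g %| k)%Z by rewrite (dvdz_trans (dvdz_gcdl _ _)) ?dvdz_gcdr.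
have gl : (g %| l)%Z by rewrite dvdz_gcdr.
have g0 : 0 < g by rewrite lt_neqAle eq_sym !gcdz_eq0 !negb_and -lt0n d0.
have gE : `|g|%N%:Z = g by rewrite gez0_abs // ltW.
have dg : d = (`|(d %/ g)%Z| * `|g|)%N.
  by rewrite -abszM divzK.
have dg0 : (0 < `|(d %/ g)%Z|)%N by move: d0; rewrite {1}dg muln_gt0 => /andP[].
have g1 : (`|g| <= 1)%N.
  have : P `|(d %/ g)%Z|%N.
    apply/asboolP; split=> //; exists (k %/ g)%Z, (l %/ g)%Z.
    have gR : (g%:~R : R) != 0 by rewrite intr_eq0 gt_eqF.
    have kE : k%:~R = (k %/ g)%Z%:~R * g%:~R :> R by rewrite -intrM divzK.
    have lE : l%:~R = (l %/ g)%Z%:~R * g%:~R :> R by rewrite -intrM divzK.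
    have dE : d%:R = `|(d %/ g)%Z|%N%:R * g%:~R :> R.
      by rewrite {1}dg natrM; congr (_ * _); rewrite pmulrn gE.
    by apply: (mulIf gR); rewrite mulrDl mulrAC -dE rel kE lE; ring.
  move=> /dmin; rewrite {1}dg -{2}[`|(d %/ g)%Z|%N]muln1 leq_pmul2l //.
have g1' : g = 1 by lia.
have [u [v uv]] := Bezoutz (gcdz d%:Z k) l; have [u' [v' uv']] := Bezoutz d%:Z k.
exists v, (u * v'), (u * u'); rewrite -g1' /g -uv -uv'; ring.
Qed.

Lemma in_T_BV_homeo {R : realType} (w : R) (F : R -> R -> R) :
  in_T_BV w F -> fibre_homeo F.
Proof.
move=> [Fc Fp Fd [dF _ dF0] _]; split => // t x y xy.
have der u : u \in `]x, y[%R -> is_derive u 1 (F t) (derive1 (F t) u).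
  by move=> _; rewrite derive1E; apply: DeriveDef.
have cont : {within `[x, y], continuous (F t)}.
  by apply: continuous_subspaceT; exact: continuous_slice.
have [u _ E] := MVT xy der cont.
by rewrite -subr_gt0 E mulr_gt0 // subr_gt0.
Qed.

(** A deviation bounded by [M] disappears after division by [n]. *)
Lemma rotation_number_unique {R : realType} (w : R) (F : R -> R -> R) (rho M t x r : R) :
  (forall n t x, `|Phi w F n t x - x - n%:~R * rho| <= M) ->
  (fun n : nat => (fib_iter w F n t x - x) / n%:R) @ \oo --> r -> r = rho.
Proof.
move=> dev cr; apply: (cvg_unique _ cr) => //.
apply/cvgrPdist_lt => /= e e0; near=> n.
have n0 : 0 < n%:R :> R by rewrite ltr0n; near: n; exact: nbhs_infty_gt.
have := dev n t x; rewrite Phi_nat -pmulrn => hn.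
have -> : rho - (fib_iter w F n t x - x) / n%:R = - (fib_iter w F n t x - x - n%:R * rho) / n%:R.
  by field; rewrite gt_eqF.
rewrite normrM normrN normfV (gtr0_norm n0) ltr_pdivrMr // [ltRHS]mulrC.
apply: le_lt_trans hn _; rewrite -ltr_pdivrMr //.
by near: n; exact: nbhs_infty_gtr.
Unshelve. all: by end_near. Qed.

Theorem mainTheorem9 (R : realType) (w : R) (F : R -> R -> R) :
  0 <= w < 1 -> irrational w -> in_T_BV w F -> ~ top_transitive w F ->
  exists p q : nat, [/\ (0 < p)%N, (0 < q)%N,
    (exists U : set (R * R), pq_tube w F p q U) &
    (exists k l : int, forall (t x r : R),
       (fun n : nat => (fib_iter w F n t x - x) / n%:R) @ \oo --> r ->
       exists m : int,
         r = k%:~R / q%:R * w + l%:~R / (p * q)%:R + m%:~R) ].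
Proof.
move=> _ wi hBV nt; have hF := in_T_BV_homeo hBV.
have [tU [xU [tV [xV [r [r0 nm]]]]]] := not_transitive_boxes hF nt.
have [rho [M dev]] := bounded_deviation_boxes hF wi r0 nm.
have hs := hsup_semiconj hF dev.
have rr : rationally_related w rho.
  apply: contrapT => ind.
  have [r1 [s [c [x1 [x2 [r10 x12 hbox]]]]]] := hsup_affine_box hF wi dev ind r0 nm.
  (* [r1 / 2] ensures that windows of width [2 * e] stay in the affine box, and [4^-1] is the bound
     required for closest returns. *)
  have d0 : 0 < Num.min (r1 / 2) 4^-1 by rewrite lt_min divr_gt0 // invr_gt0 ltr0n.
  have [e [e0 + ker]] := lev_kernel s wi ind d0.
  rewrite le_min => /andP[er e4]; have er' : 2 * e <= r1 by lra.
  case: hBV => _ _ _ [dF _ dF0] bv.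
  exact: (denjoy_contradiction hF wi dF dF0 bv hs r10 x12 hbox e0 e4 er' ker).
have [d [k [l [d0 rel bez]]]] := minimal_relation rr.
have [k' rhoE] := rho_rational d0 rel.
exists `|gcdz d%:Z k|%N, `|(d%:Z %/ gcdz d%:Z k)%Z|%N; split.
- by rewrite absz_gt0 gt_eqF // p_gt0.
- by rewrite absz_gt0 gt_eqF // q_gt0.
- by eexists; exact: (band_pq_tube hF wi dev d0 rel bez).
(* For the lift [F] itself the limit is exactly [rho], so the integer correction is 0. *)
- exists k', l => t x r' cr; exists 0; rewrite addr0.
  by rewrite -rhoE; exact: (rotation_number_unique dev cr).
Qed.
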